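(* Let $m$ be a $\sigma$-finite measure on the Borel sets of the space $\mathcal{T}$ of timelike lines, let $H_d$ be a separable Hilbert space, and let $E^{can}$ be the canonical projection valued measure on $L^2_m(\mathcal{T},H_d)$. Then $F^{can}(M):=E^{can}(\mathcal{T}_M)$ for $M\in\mathcal{C}$ defines a projection operator valued representation of the causal logic (RCL). Equivalently, $T^{can}(\Delta):=E^{can}(\mathcal{T}_\Delta)$ for $\Delta\in\mathcal{B}^{ach}$ defines a projection operator valued achronal localization (AL).
   Context: **Minkowski space.** Points of $\mathbb{R}^4$ are $\mathfrak{x}=(x_0,x)$, $x\in\mathbb{R}^3$; $\mathfrak{a}\cdot\mathfrak{b}:=a_0b_0-a_1b_1-a_2b_2-a_3b_3$, $\mathfrak{a}^{\cdot 2}:=\mathfrak{a}\cdot\mathfrak{a}$. A vector $\mathfrak{z}$ is timelike if $\mathfrak{z}^{\cdot2}>0$. **Timelike lines.** $\mathcal{T}$ is the set of timelike (straight) lines $\mathfrak{x}+\mathbb{R}\mathfrak{v}$, $\mathfrak{v}^{\cdot2}>0$, identified with $\mathbb{R}^3\times O_1\subset\mathbb{R}^6$, $O_1:=\{v\in\mathbb{R}^3:|v|<1\}$, through $(x,v)\equiv(0,x)+\mathbb{R}(1,v)$. For $M\subset\mathbb{R}^4$, $\mathcal{T}_M:=\{u\in\mathcal{T}:u\cap M\neq\emptyset\}$. If $M$ is Borel then $\mathcal{T}_M$ is $m$-measurable, i.e. measurable with respect to the completion of $m$. For $m$-measurable $\tau\subset\mathcal{T}$, $E^{can}(\tau)$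 is the operator of multiplication by the indicator function $1_\tau$ on $L^2_m(\mathcal{T},H_d)$. **AL.** A set $\Delta\subset\mathbb{R}^4$ is achronal if $(\mathfrak{x}-\mathfrak{y})^{\cdot2}\le0$ for all $\mathfrak{x},\mathfrak{y}\in\Delta$; maximal achronal if it is achronal and not properly contained in an achronal set. $\mathcal{B}^{ach}$ is the set of achronal Borel subsets of $\mathbb{R}^4$. An achronal localization (AL) on a separable Hilbert space $\mathcal{H}$ is a map $T$ assigning to each $\Delta\in\mathcal{B}^{ach}$ a nonnegative bounded operator $T(\Delta)$ on $\mathcal{H}$ with $T(\emptyset)=0$ and $\sum_nT(\Delta_n)=I$ for every sequence $(\Delta_n)$ of mutually disjoint sets in $\mathcal{B}^{ach}$ such that $\bigcup_n\Delta_n$ is maximal achronal. **RCL.** $\mathfrak{x}\perp\mathfrak{y}$ iff $\mathfrak{x}\neq\mathfrak{y}$ and $(\mathfrak{x}-\mathfrak{y})^{\cdot2}\le0$. For $M\subset\mathbb{R}^4$, $M^\perp:=\{\mathfrak{x}:\mathfrak{x}\perp\mathfrak{y}\ \forall\mathfrak{y}\in M\}$, $M^\wedge:=(M^\perp)^\perp$; $M$ is $\perp$-complete if $M=M^\wedge$. The causal logic $\mathcal{C}$ is the set of all $\perp$-complete Borel subsets of $\mathbb{R}^4$. Sets $M,N$ are orthogonal if $\mathfrak{x}\perp\mathfrak{y}$ for all $\mathfrak{x}\in M,\mathfrak{y}\in N$; $\bigvee_nM_n:=(\bigcup_nM_n)^\wedge$. A representation of the causal logic (RCL) on a separable Hilbert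 space $\mathcal{H}$ is a map $F$ assigning to each $M\in\mathcal{C}$ a nonnegative bounded operator $F(M)$ on $\mathcal{H}$ with $F(\emptyset)=0$ and $\sum_nF(M_n)=I$ for every sequence $(M_n)$ of mutually orthogonal sets in $\mathcal{C}$ with $\bigvee_nM_n=\mathbb{R}^4$. *)

(* Defs.v *)
From HB Require Import structures.
From mathcomp Require Import all_boot all_order all_algebra.
From mathcomp Require Import generic_quotient complex.
From mathcomp Require Import all_classical all_reals.
From mathcomp Require Import ereal topology normedtype sequences measure numfun.
From mathcomp Require Import measurable_realfun lebesgue_measure lebesgue_integral.
From mathcomp Require Import ring lra.

Set Implicit Arguments.
Unset Strict Implicit.
Unset Printing Implicit Defensive.

Import Order.TTheory GRing.Theory Num.Theory.
Import numFieldNormedType.Exports.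

Local Open Scope classical_set_scope.
Local Open Scope ring_scope.
Local Open Scope quotient_scope.

(* Complex inner product spaces; [dot] is linear in its first argument.  The norm
   of a normed module over R[i] is R[i]-valued, [rnorm] below is its real version. *)
HB.mixin Record isPreHilbert (R : realType) H & NormedModule R[i] H := {
  dot : H -> H -> R[i];
  dotDl : forall x y z, dot (x + y) z = dot x z + dot y z;
  dotZl : forall a x y, dot (a *: x) y = a * dot x y;
  dotC : forall x y, dot x y = (dot y x)^*;
  dot_norm : forall x, dot x x = `|x| ^+ 2
}.

#[short(type="preHilbertType")]
HB.structure Definition PreHilbert (R : realType) :=
  { H of isPreHilbert R H & NormedModule R[i] H }.

HB.factory Record Lmodule_isPreHilbert (R : realType) H & GRing.Lmodule R[i] H := {
  dot : H -> H -> R[i];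
  dotDl : forall x y z, dot (x + y) z = dot x z + dot y z;
  dotZl : forall a x y, dot (a *: x) y = a * dot x y;
  dotC : forall x y, dot x y = (dot y x)^*;
  dot_ge0 : forall x, 0 <= dot x x;
  dot_eq0 : forall x, dot x x = 0 -> x = 0
}.

HB.builders Context (R : realType) H & Lmodule_isPreHilbert R H.

Let norm (x : H) : R[i] := sqrtC (dot x x).

Let dotDr x y z : dot x (y + z) = dot x y + dot x z.
Proof. by rewrite dotC dotDl rmorphD /= -!dotC. Qed.

Let dotZr a x y : dot x (a *: y) = a^* * dot x y.
Proof. by rewrite dotC dotZl rmorphM /= -dotC. Qed.

Let norm_ge0 x : 0 <= norm x.
Proof. by rewrite sqrtC_ge0 dot_ge0. Qed.

Let normK x : norm x ^+ 2 = dot x x.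
Proof. exact: sqrtCK. Qed.

Let norm0 x : norm x = 0 -> x = 0.
Proof. by move=> x0; apply: dot_eq0; rewrite -normK x0 expr0n. Qed.

Let norm_real x : (norm x)^* = norm x.
Proof. by apply/CrealP; exact: ger0_real. Qed.

Let dot0l y : dot 0 y = 0.
Proof. by rewrite -(scale0r 0) dotZl mul0r. Qed.

Let dot0r y : dot y 0 = 0.
Proof. by rewrite dotC dot0l rmorph0. Qed.

Let dot_add_le x y : dot x y + dot y x <= 2 * (norm x * norm y).
Proof.
have [->|x0] := eqVneq x 0.
  by rewrite dot0l dot0r addr0 mulr_ge0// mulr_ge0.
have [->|y0] := eqVneq y 0.
  by rewrite dot0l dot0r addr0 mulr_ge0// mulr_ge0.
have px : 0 < norm x.
  by rewrite lt0r norm_ge0 andbT; apply: contra x0 => /eqP/norm0 ->.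
have py : 0 < norm y.
  by rewrite lt0r norm_ge0 andbT; apply: contra y0 => /eqP/norm0 ->.
rewrite -(ler_pM2l (mulr_gt0 px py)) -subr_ge0.
have := dot_ge0 (norm y *: x + (- norm x) *: y).
rewrite dotDl !dotDr !dotZl !dotZr !rmorphN /= !norm_real -!normK.
congr (0 <= _); ring.
Qed.

Let ler_normD x y : norm (x + y) <= norm x + norm y.
Proof.
rewrite -(@ler_pXn2r _ 2)// ?nnegrE ?addr_ge0//.
rewrite normK sqrrD !normK dotDl !dotDr.
have -> : dot x x + dot x y + (dot y x + dot y y)
  = (dot x y + dot y x) + (dot x x + dot y y) by ring.
have -> : dot x x + norm x * norm y *+ 2 + dot y y =
  2 * (norm x * norm y) + (dot x x + dot y y) by ring.
by rewrite lerD2r.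
Qed.

Let normrZ (a : R[i]) x : norm (a *: x) = `|a| * norm x.
Proof.
by rewrite /norm dotZl dotZr mulrA -normCK rootCMl ?exprn_ge0// sqrCK.
Qed.

HB.instance Definition _ :=
  Lmodule_isNormed.Build R[i] H ler_normD normrZ norm0.

HB.instance Definition _ :=
  isPreHilbert.Build R H dotDl dotZl dotC (fun x => esym (normK x)).
HB.end.

Definition separable (X : topologicalType) : Prop :=
  exists2 D : set X, countable D & dense D.

Record separable_hilbert (R : realType) (H : preHilbertType R) : Prop := {
  hilbert_complete : forall F : set_system H, ProperFilter F -> cauchy F -> cvg F;
  hilbert_separable : separable H
}.

Notation borel X := (g_sigma_algebraType (@open X)).

Section prehilbert.
Context {R : realType} {H : preHilbertType R}.
Implicit Types x y z : H.

Definition rnorm x : R := complex.Re `|x|.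

Lemma rnormE x : `|x| = (rnorm x)%:C%C.
Proof.
have := normr_ge0 x.
by rewrite /rnorm; case: `|x| => a b; rewrite lecE /= => /andP[/eqP -> _].
Qed.

Lemma rnorm_ge0 x : 0 <= rnorm x.
Proof.
by have := normr_ge0 x; rewrite /rnorm; case: `|x| => a b; rewrite lecE /= => /andP[].
Qed.

Lemma dotDr x y z : dot x (y + z) = dot x y + dot x z.
Proof. by rewrite dotC dotDl rmorphD /= -!dotC. Qed.

Lemma dotZr a x y : dot x (a *: y) = a^* * dot x y.
Proof. by rewrite dotC dotZl rmorphM /= -dotC. Qed.

Lemma cReD (a b : R[i]) : complex.Re (a + b) = complex.Re a + complex.Re b.
Proof. by case: a b => [? ?] [? ?]. Qed.

Lemma cImD (a b : R[i]) : complex.Im (a + b) = complex.Im a + complex.Im b.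
Proof. by case: a b => [? ?] [? ?]. Qed.

Lemma cReM (a b : R[i]) : complex.Re (a * b) =
  complex.Re a * complex.Re b - complex.Im a * complex.Im b.
Proof. by case: a b => [? ?] [? ?]. Qed.

Lemma cImM (a b : R[i]) : complex.Im (a * b) =
  complex.Re a * complex.Im b + complex.Im a * complex.Re b.
Proof. by case: a b => [? ?] [? ?]. Qed.

Lemma mulcE (a b : R[i]) : a * b =
  Complex (complex.Re a * complex.Re b - complex.Im a * complex.Im b)
          (complex.Re a * complex.Im b + complex.Im a * complex.Re b).
Proof. by case: a b => [? ?] [? ?]. Qed.

Lemma cReJ (a : R[i]) : complex.Re a^* = complex.Re a.
Proof. by case: a. Qed.

Lemma cImJ (a : R[i]) : complex.Im a^* = - complex.Im a.
Proof. by case: a. Qed.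

Lemma dotxx x : dot x x = (rnorm x ^+ 2)%:C%C.
Proof. by rewrite dot_norm rnormE rmorphXn. Qed.

Lemma rnormZ a x : rnorm (a *: x) = complex.Re `|a| * rnorm x.
Proof. by rewrite /rnorm normrZ rnormE cReM /= mulr0 subr0. Qed.

Lemma rnormN x : rnorm (- x) = rnorm x.
Proof. by rewrite /rnorm normrN. Qed.

Lemma rnormD2 x y : rnorm (x + y) ^+ 2 =
  rnorm x ^+ 2 + rnorm y ^+ 2 + 2 * complex.Re (dot x y).
Proof.
have Re_xx z : rnorm z ^+ 2 = complex.Re (dot z z) by rewrite dotxx.
rewrite 3!Re_xx dotDl !dotDr !cReD [dot y x]dotC cReJ; ring.
Qed.

Lemma Im_dot x y : complex.Im (dot x y) = - complex.Re (dot ('i *: x) y).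
Proof. by rewrite dotZl cReM /= mul0r mul1r sub0r opprK. Qed.

Lemma Re_dot x y : complex.Re (dot x y) =
  2^-1 * (rnorm (x + y) ^+ 2 - (rnorm x ^+ 2 + rnorm y ^+ 2)).
Proof. by rewrite rnormD2; field. Qed.

Lemma Re_dot_le x y : `|complex.Re (dot x y)| <= rnorm x ^+ 2 + rnorm y ^+ 2.
Proof.
have p := sqr_ge0 (rnorm (x + y)); have q := sqr_ge0 (rnorm (x - y)).
rewrite rnormD2 in p; rewrite rnormD2 rnormN in q.
have : complex.Re (dot x (- y)) = - complex.Re (dot x y).
  by rewrite -scaleN1r dotZr cReM; case: (dot x y) => a b /=; ring.
move=> e; rewrite e in q; have := sqr_ge0 (rnorm x); have := sqr_ge0 (rnorm y).
rewrite ler_norml; move: p q; move: (rnorm x ^+2) (rnorm y ^+ 2) (complex.Re _).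
by move=> *; apply/andP; split; lra.
Qed.

Lemma continuous_rnorm : continuous (rnorm : H -> R).
Proof.
move=> x; apply/cvgrPdist_lt => e e0.
have e0' : 0 < e%:C%C by rewrite ltcE /= eqxx.
have := @norm_continuous _ H x; move=> /cvgrPdist_lt/(_ _ e0').
apply: filterS => y; rewrite !rnormE -rmorphB /= normc_def /=.
by rewrite expr0n addr0 sqrtr_sqr ltcR.
Qed.

Lemma cinv_nat_lt (e : R[i]) : 0 < e -> exists k, k.+1%:R^-1 < e.
Proof.
case: e => a b; rewrite ltcE /= => /andP[/eqP -> a0].
exists (Num.truncn a^-1).
change (Complex a 0) with (a%:C)%C.
have -> : (Num.truncn a^-1).+1%:R^-1 = ((Num.truncn a^-1).+1%:R^-1)%:C%C :> R[i].
  by rewrite fmorphV rmorph_nat.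
rewrite ltcR invf_plt ?posrE// truncnS_gt//.
Qed.

End prehilbert.

Section measurable.
Context {R : realType} {H : preHilbertType R} d {T : measurableType d}.
Hypothesis sepH : separable H.
Implicit Types f g : T -> H.

Definition borel_fun f := measurable_fun setT (f : T -> borel H).

Lemma borel_funP f :
  (forall U : set H, open U -> measurable (f @^-1` U)) <-> borel_fun f.
Proof.
split=> [mf|mf U oU]; last first.
  by rewrite -[X in measurable X]setTI; apply: mf => //; exact: sub_sigma_algebra.
by apply: measurability => // _ [U oU <-]; rewrite setTI; exact: mf.
Qed.

Lemma countable_base : exists b : nat -> nat -> set H,
  (forall i k, open (b i k)) /\ forall x e, 0 < e -> exists i k,
    b i k x /\ b i k `<=` ball x e.
Proof.
have [D cD dD] := sepH.
have [c cdense] : exists c : nat -> H, forall x e, 0 < e -> exists i, ball x e (c i).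
  have [f Df] : exists f : nat -> H, D `<=` range f.
    move: cD => /countable_injP[g ginj].
    exists (fun n => xget 0 [set x | D x /\ g x = n]) => x Dx.
    have [|Dy gyx] := @xgetPex _ 0 [set y | D y /\ g y = g x]; first by exists x.
    by exists (g x) => //; apply: ginj; rewrite ?inE.
  exists f => x e e0.
  have [y [xy /Df[i _ fiy]]] := dD (ball x e) (ex_intro _ x (ballxx x e0)) (ball_open x e).
  by exists i; rewrite fiy.
exists (fun i k => ball (c i) k.+1%:R^-1); split=> [i k|x e e0].
  exact: ball_open.
have e20 : 0 < e / 2 by rewrite divr_gt0.
have [k ke] := cinv_nat_lt e20.
have [|i xi] := cdense x k.+1%:R^-1; first by rewrite invr_gt0.
exists i, k; split; first exact: ball_sym.
move=> y iy; rewrite [e]splitr; apply: ball_triangle.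
  by apply: le_ball xi; exact: ltW.
by apply: le_ball iy; exact: ltW.
Qed.

Lemma measurable_pair_open f g (W : set (H * H)) :
  borel_fun f -> borel_fun g -> open W -> measurable [set x | W (f x, g x)].
Proof.
move=> /borel_funP mf /borel_funP mg oW.
have [b [bo bbase]] := countable_base.
pose F i k j l := if `[< b i k `*` b j l `<=` W >]
  then f @^-1` (b i k) `&` g @^-1` (b j l) else set0.
have -> : [set x | W (f x, g x)] =
    \bigcup_i \bigcup_k \bigcup_j \bigcup_l F i k j l.
  apply/seteqP; split=> x /=.
    move=> Wx.
    have : nbhs (f x, g x) W by apply: open_nbhs_nbhs.
    move=> /nbhs_ballP[e /= e0 eW].
    have [i [k [fik ik]]] := bbase (f x) e e0.
    have [j [l [gjl jl]]] := bbase (g x) e e0.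
    exists i => //; exists k => //; exists j => //; exists l => //.
    rewrite /F asboolT//= => -[y z] /= [/ik y1 /jl z1].
    by apply: eW; split.
  move=> [i _ [k _ [j _ [l _]]]]; rewrite /F; case: asboolP => // bW [fx gx].
  exact: bW.
do 4 (apply: bigcupT_measurable => ?).
by rewrite /F; case: ifP => // _; apply: measurableI; [exact: mf|exact: mg].
Qed.

Lemma borel_fun_op (op : H -> H -> H) f g :
  continuous (fun z : H * H => op z.1 z.2) ->
  borel_fun f -> borel_fun g -> borel_fun (fun x => op (f x) (g x)).
Proof.
move=> /continuousP cop mf mg; apply/borel_funP => U oU.
exact: (measurable_pair_open mf mg (cop U oU)).
Qed.

Lemma borel_fun_rnorm f : borel_fun f -> measurable_fun setT (rnorm \o f).
Proof.
move=> /borel_funP mf.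
apply: (measurability _ (RGenOInfty.measurableE R)).
move=> _ [_ [x ->] <-]; rewrite setTI comp_preimage; apply: mf.
by have /continuousP := @continuous_rnorm R H; apply; exact: rray_open.
Qed.

Lemma borel_funD f g : borel_fun f -> borel_fun g -> borel_fun (f \+ g).
Proof. by apply: borel_fun_op; exact: add_continuous. Qed.

Lemma borel_funZ a f : borel_fun f -> borel_fun (a \*: f).
Proof.
by move=> mf; apply: (borel_fun_op (op := fun x _ => a *: x) _ mf mf) => z;
  apply: cvgZr; exact: cvg_fst.
Qed.

Lemma borel_fun_Redot f g : borel_fun f -> borel_fun g ->
  measurable_fun setT (fun x => complex.Re (dot (f x) (g x))).
Proof.
move=> mf mg; under eq_fun do rewrite Re_dot.
apply: measurable_funM => //; apply: measurable_funB; last apply: measurable_funD.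
all: by apply: measurable_funX; apply: borel_fun_rnorm => //; exact: borel_funD.
Qed.

End measurable.

Definition sq_integrable (R : realType) (H : preHilbertType R) d
    (T : measurableType d) (mu : {measure set T -> \bar R}) (f : T -> H) :=
  borel_fun f /\ (\int[mu]_x (rnorm (f x) ^+ 2)%:E < +oo)%E.

Record sq_fun (R : realType) (H : preHilbertType R) d
    (T : measurableType d) (mu : {measure set T -> \bar R}) :=
  SqFun { sq_fun_val :> T -> H; sq_funP : sq_integrable mu sq_fun_val }.

Section L2_type.
Context {R : realType} {H : preHilbertType R} d {T : measurableType d}.
Variable mu : {measure set T -> \bar R}.

HB.instance Definition _ := gen_eqMixin (sq_fun H mu).
HB.instance Definition _ := gen_choiceMixin (sq_fun H mu).

Definition sq_ae_eq (f g : sq_fun H mu) : bool :=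
  `[< {ae mu, forall x, f x = g x} >].

Let sq_ae_eq_refl : reflexive sq_ae_eq.
Proof. by move=> f; apply/asboolP; apply: aeW. Qed.

Let sq_ae_eq_sym : symmetric sq_ae_eq.
Proof.
by move=> f g; apply/idP/idP => /asboolP h; apply/asboolP; apply: filterS h.
Qed.

Let sq_ae_eq_trans : transitive sq_ae_eq.
Proof.
move=> g f h /asboolP fg /asboolP gh; apply/asboolP.
by apply: filterS2 fg gh => x -> ->.
Qed.

Canonical sq_ae_eq_equiv :=
  EquivRel sq_ae_eq sq_ae_eq_refl sq_ae_eq_sym sq_ae_eq_trans.

(* Classes of Borel square-integrable functions modulo equality almost everywhere.
   The separability of H enters only through the instances below: it makes sums of
   Borel functions Borel. *)
Definition L2 (hH : separable_hilbert H) : Type := {eq_quot sq_ae_eq}.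

End L2_type.
Arguments L2 {R H d T} mu hH.

Section L2_space.
Context {R : realType} {H : preHilbertType R} d {T : measurableType d}.
Variables (mu : {measure set T -> \bar R}) (hH : separable_hilbert H).
Local Notation L2 := (L2 mu hH).
Local Notation sepH := (hilbert_separable hH).

HB.instance Definition _ := Choice.on L2.
HB.instance Definition _ := EqQuotient.on L2.

Definition L2_fun (u : L2) : T -> H := repr u.
Coercion L2_fun : L2 >-> Funclass.

Lemma L2_sq (u : L2) : sq_integrable mu u.
Proof. exact: sq_funP. Qed.

Lemma L2_borel (u : L2) : borel_fun u.
Proof. by have [] := L2_sq u. Qed.

Definition L2_class (f : T -> H) (sf : sq_integrable mu f) : L2 := \pi_L2 (SqFun sf).

Lemma L2_classE (f : T -> H) (sf : sq_integrable mu f) :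
  {ae mu, forall x, L2_class sf x = f x}.
Proof.
have : repr (L2_class sf) = SqFun sf %[mod L2] by rewrite reprK.
by move=> /eqmodP /asboolP.
Qed.

Lemma L2_eq (u v : L2) : {ae mu, forall x, u x = v x} -> u = v.
Proof.
by move=> uv; rewrite -[u]reprK -[v]reprK; apply/eqmodP/asboolP.
Qed.

Lemma measurable_rnorm2 (f : T -> H) : borel_fun f ->
  measurable_fun setT (fun x => (rnorm (f x) ^+ 2)%:E).
Proof. 
by move=> mf; apply/measurable_EFinP; apply: measurable_funX; exact: borel_fun_rnorm.
Qed.

Lemma sq_integrableP (f : T -> H) : sq_integrable mu f <->
  borel_fun f /\ mu.-integrable setT (fun x => (rnorm (f x) ^+ 2)%:E).
Proof.
split=> -[mf If]; split=> //.
  apply/integrableP; split; first exact: measurable_rnorm2.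
  by under eq_integral do rewrite gee0_abs ?lee_fin ?sqr_ge0//.
by have := integrable_lty measurableT If.
Qed.

Lemma sq_integrable0 : sq_integrable mu (fun=> 0 : H).
Proof.
apply/sq_integrableP; split; first exact: measurable_cst.
under [X in _.-integrable _ X]eq_fun do rewrite /rnorm normr0 expr0n.
exact: integrable0.
Qed.

Lemma sq_integrableD (f g : T -> H) : sq_integrable mu f ->
  sq_integrable mu g -> sq_integrable mu (f \+ g).
Proof.
move=> /sq_integrableP[mf If] /sq_integrableP[mg Ig].
have mfg := borel_funD sepH mf mg.
apply/sq_integrableP; split=> //.
have I2 := integrableZl measurableT 3 (integrableD measurableT If Ig).
apply: le_integrable I2 => //; first exact: measurable_rnorm2.
move=> x _ /=; rewrite lee_fin.
have p0 := sqr_ge0 (rnorm (f x)); have q0 := sqr_ge0 (rnorm (g x)).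
rewrite !ger0_norm ?sqr_ge0// ?mulr_ge0 ?addr_ge0//.
rewrite rnormD2; have := Re_dot_le (f x) (g x); rewrite ler_norml => /andP[_].
by move: p0 q0; lra.
Qed.

Lemma sq_integrableZ a (f : T -> H) : sq_integrable mu f ->
  sq_integrable mu (a \*: f).
Proof.
move=> /sq_integrableP[mf If].
apply/sq_integrableP; split; first exact: borel_funZ sepH _ _ mf.
under [X in _.-integrable _ X]eq_fun do rewrite rnormZ exprMn EFinM.
exact: integrableZl.
Qed.

Definition L2_zero : L2 := L2_class sq_integrable0.
Definition L2_add (u v : L2) : L2 := L2_class (sq_integrableD (L2_sq u) (L2_sq v)).
Definition L2_scale a (u : L2) : L2 := L2_class (sq_integrableZ a (L2_sq u)).
Definition L2_opp (u : L2) : L2 := L2_scale (-1) u.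

Let add_E u v : {ae mu, forall x, L2_add u v x = u x + v x}.
Proof. exact: L2_classE. Qed.
Let scale_E a u : {ae mu, forall x, L2_scale a u x = a *: u x}.
Proof. exact: L2_classE. Qed.
Let zero_E : {ae mu, forall x, L2_zero x = 0}.
Proof. exact: L2_classE. Qed.

Let addA : associative L2_add.
Proof.
move=> u v w; apply: L2_eq.
by apply: filterS (filterI (add_E u (L2_add v w)) (filterI (add_E v w) (filterI (add_E (L2_add u v) w) (add_E u v)))) => x [-> [-> [-> ->]]]; rewrite addrA.
Qed.

Let addC : commutative L2_add.
Proof.
move=> u v; apply: L2_eq; by apply: filterS (filterI (add_E u v) (add_E v u)) => x [-> ->]; rewrite addrC.
Qed.

Let add0 : left_id L2_zero L2_add.
Proof.
move=> u; apply: L2_eq; by apply: filterS (filterI (add_E L2_zero u) (zero_E)) => x [-> ->]; rewrite add0r.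
Qed.

Let addN : left_inverse L2_zero L2_opp L2_add.
Proof.
move=> u; apply: L2_eq.
by apply: filterS (filterI (add_E (L2_opp u) u) (filterI (scale_E (-1) u) (zero_E))) => x [-> [-> ->]]; rewrite scaleN1r addNr.
Qed.

HB.instance Definition _ := GRing.isZmodule.Build L2 addA addC add0 addN.

Let scaleA a b (u : L2) : L2_scale a (L2_scale b u) = L2_scale (a * b) u.
Proof.
apply: L2_eq.
by apply: filterS (filterI (scale_E a (L2_scale b u)) (filterI (scale_E b u) (scale_E (a * b) u))) => x [-> [-> ->]]; rewrite scalerA.
Qed.

Let scale1 : left_id 1 L2_scale.
Proof.
move=> u; apply: L2_eq; apply: filterS (scale_E 1 u) => x ->.
by rewrite scale1r.
Qed.

Let scaleDr : right_distributive L2_scale +%R.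
Proof.
move=> a u v; apply: L2_eq.
by apply: filterS (filterI (scale_E a (u + v)) (filterI (add_E u v) (filterI (add_E (L2_scale a u) (L2_scale a v)) (filterI (scale_E a u) (scale_E a v))))) => x [-> [-> [-> [-> ->]]]]; rewrite scalerDr.
Qed.

Let scaleDl (u : L2) : {morph L2_scale^~ u : a b / a + b}.
Proof.
move=> a b; apply: L2_eq.
by apply: filterS (filterI (scale_E (a + b) u) (filterI (add_E (L2_scale a u) (L2_scale b u)) (filterI (scale_E a u) (scale_E b u)))) => x [-> [-> [-> ->]]]; rewrite scalerDl.
Qed.

HB.instance Definition _ :=
  GRing.Zmodule_isLmodule.Build R[i] L2 scaleA scale1 scaleDr scaleDl.

Lemma L2_addE (u v : L2) : {ae mu, forall x, (u + v : L2) x = u x + v x}.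
Proof. exact: add_E. Qed.

Lemma L2_scaleE a (u : L2) : {ae mu, forall x, (a *: u : L2) x = a *: u x}.
Proof. exact: scale_E. Qed.

Lemma L2_zeroE : {ae mu, forall x, (0 : L2) x = 0}.
Proof. exact: zero_E. Qed.

Definition L2_dot (u v : L2) : R[i] :=
  Complex (\int[mu]_x complex.Re (dot (u x) (v x)))
          (\int[mu]_x complex.Im (dot (u x) (v x))).

Let Re_int (f g : T -> H) : sq_integrable mu f -> sq_integrable mu g ->
  mu.-integrable setT (EFin \o (fun x => complex.Re (dot (f x) (g x)))).
Proof.
move=> /sq_integrableP[mf If] /sq_integrableP[mg Ig].
apply: le_integrable (integrableD measurableT If Ig) => //.
  by apply/measurable_EFinP; exact: borel_fun_Redot sepH _ _ mf mg.
move=> x _ /=; rewrite lee_fin (le_trans (Re_dot_le _ _))//.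
by rewrite ler_norm.
Qed.

Let Im_int (f g : T -> H) : sq_integrable mu f -> sq_integrable mu g ->
  mu.-integrable setT (EFin \o (fun x => complex.Im (dot (f x) (g x)))).
Proof.
move=> sf sg; rewrite (_ : _ \o _ =
  (fun x => - (complex.Re (dot ('i *: f x) (g x)))%:E)%E).
  by apply: integrableN; apply: Re_int => //; exact: sq_integrableZ.
by apply/funext => x /=; rewrite Im_dot EFinN.
Qed.

Let Rintegral_ae (f g : T -> R) : mu.-integrable setT (EFin \o f) ->
  mu.-integrable setT (EFin \o g) -> {ae mu, forall x, f x = g x} ->
  \int[mu]_x f x = \int[mu]_x g x.
Proof.
move=> /integrableP[mf _] /integrableP[mg _] fg; congr fine.
by apply: ae_eq_integral => //; apply: filterS fg => x /= ->.
Qed.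

Let intD (f g : T -> R) : mu.-integrable setT (EFin \o f) ->
  mu.-integrable setT (EFin \o g) ->
  mu.-integrable setT (EFin \o (fun x => f x + g x)).
Proof. by move=> If Ig; exact: (integrableD measurableT If Ig). Qed.

Let intB (f g : T -> R) : mu.-integrable setT (EFin \o f) ->
  mu.-integrable setT (EFin \o g) ->
  mu.-integrable setT (EFin \o (fun x => f x - g x)).
Proof. by move=> If Ig; exact: (integrableB measurableT If Ig). Qed.

Let intZ r (f : T -> R) : mu.-integrable setT (EFin \o f) ->
  mu.-integrable setT (EFin \o (fun x => r * f x)).
Proof. by move=> If; exact: (integrableZl measurableT r If). Qed.

Let dotDl (u v w : L2) : L2_dot (u + v) w = L2_dot u w + L2_dot v w.
Proof.
congr Complex.
- rewrite -RintegralD//; [|exact: Re_int (L2_sq _) (L2_sq _)..].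
  apply: Rintegral_ae; first exact: Re_int (L2_sq _) (L2_sq _).
    by apply: intD; exact: Re_int (L2_sq _) (L2_sq _).
  by apply: filterS (L2_addE u v) => x ->; rewrite dotDl cReD.
- rewrite -RintegralD//; [|exact: Im_int (L2_sq _) (L2_sq _)..].
  apply: Rintegral_ae; first exact: Im_int (L2_sq _) (L2_sq _).
    by apply: intD; exact: Im_int (L2_sq _) (L2_sq _).
  by apply: filterS (L2_addE u v) => x ->; rewrite dotDl cImD.
Qed.

Let dotZl a (u v : L2) : L2_dot (a *: u) v = a * L2_dot u v.
Proof.
have IRe r : mu.-integrable setT (EFin \o (fun x => r * complex.Re (dot (u x) (v x)))).
  by apply: intZ; exact: Re_int (L2_sq _) (L2_sq _).
have IIm r : mu.-integrable setT (EFin \o (fun x => r * complex.Im (dot (u x) (v x)))).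
  by apply: intZ; exact: Im_int (L2_sq _) (L2_sq _).
have RZRe r : \int[mu]_x (r * complex.Re (dot (u x) (v x))) =
    r * \int[mu]_x (complex.Re (dot (u x) (v x))).
  by apply: RintegralZl => //; exact: Re_int (L2_sq _) (L2_sq _).
have RZIm r : \int[mu]_x (r * complex.Im (dot (u x) (v x))) =
    r * \int[mu]_x (complex.Im (dot (u x) (v x))).
  by apply: RintegralZl => //; exact: Im_int (L2_sq _) (L2_sq _).
rewrite [RHS]mulcE; congr Complex.
- rewrite -RZRe -RZIm -RintegralB//.
  apply: Rintegral_ae; first exact: Re_int (L2_sq _) (L2_sq _).
    by apply: intB; [exact: IRe|exact: IIm].
  by apply: filterS (L2_scaleE a u) => x ->; rewrite dotZl cReM.
- rewrite -RZRe -RZIm -RintegralD//.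
  apply: Rintegral_ae; first exact: Im_int (L2_sq _) (L2_sq _).
    by apply: intD; [exact: IIm|exact: IRe].
  by apply: filterS (L2_scaleE a u) => x ->; rewrite dotZl cImM.
Qed.

Let dotC (u v : L2) : L2_dot u v = (L2_dot v u)^*.
Proof.
congr Complex.
  by apply: eq_Rintegral => x _; rewrite dotC cReJ.
rewrite -[RHS]mulN1r -RintegralZl//; last exact: Im_int (L2_sq _) (L2_sq _).
by apply: eq_Rintegral => x _; rewrite dotC cImJ mulN1r.
Qed.

Let dotuu (u : L2) : L2_dot u u = (\int[mu]_x (rnorm (u x) ^+ 2))%:C%C.
Proof.
congr Complex; first by apply: eq_Rintegral => x _; rewrite dotxx.
under eq_Rintegral do rewrite dotxx /=.
by rewrite Rintegral_cst// mul0r.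
Qed.

Let dot_ge0 (u : L2) : 0 <= L2_dot u u.
Proof. by rewrite dotuu lecE /= eqxx/=; apply: Rintegral_ge0 => x _; exact: sqr_ge0. Qed.

Let dot_eq0 (u : L2) : L2_dot u u = 0 -> u = 0.
Proof.
rewrite dotuu => -[u0]; apply: L2_eq.
have [_ /integrableP[mu2 Iu]] := (sq_integrableP u).1 (L2_sq u).
have : (\int[mu]_x `|(rnorm (u x) ^+ 2)%:E| = 0)%E.
  move: u0; rewrite /Rintegral => u0.
  apply/eqP; rewrite -fine_eq0 ?ge0_fin_numE ?integral_ge0//; apply/eqP.
  rewrite -[RHS]u0; congr fine; apply: eq_integral => x _.
  by rewrite gee0_abs// lee_fin sqr_ge0.
move=> /(ae_eq_integral_abs mu measurableT mu2) u20.
apply: filterS2 u20 L2_zeroE => x /(_ I)[/eqP]; rewrite sqrf_eq0 => /eqP ux0 ->.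
by apply/eqP; rewrite -normr_eq0 rnormE ux0.
Qed.

HB.instance Definition _ := Lmodule_isPreHilbert.Build R L2
  dotDl dotZl dotC dot_ge0 dot_eq0.

End L2_space.

Section multiplication_by_indicator.
Context {R : realType} {H : preHilbertType R} d {T : measurableType d}.
Variables (mu : {measure set T -> \bar R}) (hH : separable_hilbert H).

(* Members of the completed sigma-algebra: unions of a measurable and a negligible
   set. *)
Definition completion_measurable (tau : set T) : Prop :=
  completed_algebra_gen mu tau.

(* The multiplication operator by the indicator function of tau: its value at u is
   the element of L2 equal to \1_tau u almost everywhere.  This element is unique
   by [L2_eq] and exists when tau is measurable for the completion ([EcanE]). *)
Definition Ecan (tau : set T) (u : L2 mu hH) : L2 mu hH :=
  xget 0 [set w : L2 mu hH | {ae mu, forall x, w x = (\1_tau x : R[i]) *: u x}].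

Lemma sq_integrable_indic (B : set T) (f : T -> H) : measurable B ->
  sq_integrable mu f -> sq_integrable mu (fun x => (\1_B x : R[i]) *: f x).
Proof.
move=> mB /sq_integrableP[mf If].
have mBf : borel_fun (fun x => (\1_B x : R[i]) *: f x).
  apply/borel_funP => U oU.
  have -> : (fun x => (\1_B x : R[i]) *: f x) @^-1` U =
      (B `&` f @^-1` U) `|` (~` B `&` (fun=> 0 : H) @^-1` U).
    apply/seteqP; split=> x /=; rewrite indicE.
      have [Bx|nBx] := pselect (B x).
        by rewrite mem_set// scale1r => ?; left.
      by rewrite memNset// scale0r => ?; right.
    by move=> [[Bx]|[nBx]]; rewrite ?(mem_set Bx) ?(memNset nBx) ?scale1r ?scale0r.
  have m0 : borel_fun (fun _ : T => 0 : H) by exact: measurable_cst.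
  apply: measurableU; apply: measurableI => //.
  - by move/borel_funP : mf; exact.
  - exact: measurableC.
  - by move/borel_funP : m0; exact.
apply/sq_integrableP; split=> //.
apply: le_integrable If => //; first exact: measurable_rnorm2.
move=> x _; rewrite lee_fin !ger0_norm ?sqr_ge0// rnormZ indicE.
case: (x \in B); first by rewrite normr1 /= mul1r.
by rewrite normr0 /= mul0r expr0n sqr_ge0.
Qed.

Lemma EcanE (tau : set T) (u : L2 mu hH) : completion_measurable tau ->
  {ae mu, forall x, Ecan tau u x = (\1_tau x : R[i]) *: u x}.
Proof.
move=> [B mB [N nN <-]].
apply: (@xgetPex _ 0 [set w : L2 mu hH |
  {ae mu, forall x, w x = (\1_(B `|` N) x : R[i]) *: u x}]).
exists (L2_class hH (sq_integrable_indic mB (L2_sq u))).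
have nN' : {ae mu, forall x, ~ N x}.
  by apply: negligibleS nN => x /=; rewrite notK.
apply: filterS2 nN' (L2_classE hH (sq_integrable_indic mB (L2_sq u))) => x nNx ->.
congr (_ *: _); rewrite !indicE; congr (_%:R); congr nat_of_bool.
by rewrite in_setU (memNset nNx) orbF.
Qed.

End multiplication_by_indicator.
Arguments Ecan {R H d T} mu hH tau u.

Section operators.
Context {R : realType} {H : preHilbertType R}.
Implicit Type A : H -> H.

Definition bounded_operator A : Prop :=
  linear A /\ exists C : R[i], forall x, `|A x| <= C * `|x|.

Definition nonnegative_operator A : Prop := forall x, 0 <= dot (A x) x.

Definition orthogonal_projection A : Prop :=
  [/\ bounded_operator A, forall x, A (A x) = A x
    & forall x y, dot (A x) y = dot x (A y)].

End operators.

Section minkowski.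
Variable R : realType.

Definition minkowski : Type := (R * 'rV[R]_3)%type.
HB.instance Definition _ := Topological.on minkowski.
HB.instance Definition _ := GRing.Zmodule.on minkowski.

Implicit Types (x y : minkowski) (M N D : set minkowski).

Definition mdot x y : R := x.1 * y.1 - \sum_(i < 3) x.2 ord0 i * y.2 ord0 i.

Definition msquare x : R := mdot x x.

Definition borel_set M : Prop := <<s @open minkowski >> M.

Definition achronal D : Prop :=
  forall x y, D x -> D y -> msquare (x - y) <= 0.

Definition maximal_achronal D : Prop :=
  achronal D /\ forall D', achronal D' -> D `<=` D' -> D' = D.

Definition borel_achronal D : Prop := borel_set D /\ achronal D.

Definition perp x y : Prop := x <> y /\ msquare (x - y) <= 0.

Definition perp_compl M : set minkowski := [set x | forall y, M y -> perp x y].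

Definition perp_closure M : set minkowski := perp_compl (perp_compl M).

Definition causal_logic M : Prop := borel_set M /\ M = perp_closure M.

Definition orthogonal_sets M N : Prop := forall x y, M x -> N y -> perp x y.

Definition velocities : set 'rV[R]_3 :=
  [set v | Num.sqrt (\sum_(i < 3) v ord0 i ^+ 2) < 1].

Lemma velocities0 : 0 \in velocities.
Proof.
rewrite inE /velocities /=; under eq_bigr do rewrite mxE expr0n.
by rewrite big1// sqrtr0.
Qed.

(* The timelike lines, parametrized by R^3 x O_1 through [line] and with the
   subspace topology of R^3 x R^3. *)
Definition timelike_lines : Type := ('rV[R]_3 * velocities)%type.
HB.instance Definition _ := Topological.on timelike_lines.
HB.instance Definition _ := Choice.on timelike_lines.
HB.instance Definition _ := isPointed.Build timelike_lines
  (0, exist _ 0 velocities0).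

Definition line (u : timelike_lines) : set minkowski :=
  [set (t, u.1 + t *: \val u.2) | t in [set: R]].

Definition lines_meeting M : set timelike_lines :=
  [set u | (line u `&` M) !=set0].

End minkowski.

Section localizations.
Context {R : realType} {H : preHilbertType R}.
Local Notation E4 := (minkowski R).

(* The values of T outside the Borel achronal sets, and those of F outside the causal
   logic, are irrelevant.  The series of operators converge strongly. *)
Record achronal_localization (T : set E4 -> H -> H) : Prop := {
  AL_hilbert : separable_hilbert H;
  AL_bounded : forall D, borel_achronal D -> bounded_operator (T D);
  AL_nonneg : forall D, borel_achronal D -> nonnegative_operator (T D);
  AL_set0 : forall x, T set0 x = 0;
  AL_sum : forall D : nat -> set E4,
    (forall n, borel_achronal (D n)) ->
    trivIset setT D ->
    maximal_achronal (\bigcup_n D n) ->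
    forall x, series (fun n => T (D n) x) @ \oo --> x
}.

Record causal_logic_representation (F : set E4 -> H -> H) : Prop := {
  RCL_hilbert : separable_hilbert H;
  RCL_bounded : forall M, causal_logic M -> bounded_operator (F M);
  RCL_nonneg : forall M, causal_logic M -> nonnegative_operator (F M);
  RCL_set0 : forall x, F set0 x = 0;
  RCL_sum : forall M : nat -> set E4,
    (forall n, causal_logic (M n)) ->
    (forall n k, n <> k -> orthogonal_sets (M n) (M k)) ->
    perp_closure (\bigcup_n M n) = setT ->
    forall x, series (fun n => F (M n) x) @ \oo --> x
}.

End localizations.

Section canonical.
Context {R : realType} {Hd : preHilbertType R}.
Variables (m : {sigma_finite_measure set (borel (timelike_lines R)) -> \bar R})
  (hHd : separable_hilbert Hd).

Definition Fcan (M : set (minkowski R)) : L2 m hHd -> L2 m hHd :=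
  Ecan m hHd (lines_meeting M).

Definition Tcan (D : set (minkowski R)) : L2 m hHd -> L2 m hHd :=
  Ecan m hHd (lines_meeting D).

End canonical.
Arguments Fcan {R Hd} m hHd M.
Arguments Tcan {R Hd} m hHd D.

(* Main.v *)
(** No theory of analytic sets is needed: the sets [lines_meeting M] at stake are
    Borel.  A maximal achronal set L meets every timelike line in exactly one point:
    otherwise the times at which the line is in the past, respectively in the future,
    of a point of L would disconnect R.  The hitting time u |-> tau u is continuous,
    because tau u < t means that the point of u at time t lies in the open future of a
    point of L.  Extending an achronal Borel set D to such an L, [lines_meeting D] is
    the preimage of D under the continuous map sending a line to its point in L.  A
    member M of the causal logic contains the diamond between any two of its
    timelike related points, so a line meeting M either meets it at a rational time or
    meets the achronal Borel set of those points of M that have no point of M in their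
    future.

    The same connectedness argument shows that the sets of lines meeting the members of
    an orthogonal sequence with join R^4, or of a partition of a maximal achronal set,
    partition the space of lines; the strong convergence of the operators is then
    dominated convergence.  That L2 is complete is Riesz-Fischer.  It is separable since
    the Borel sets of the lines are generated by a countable pi-system, whose indicator
    functions times a dense sequence of vectors span a dense subgroup. *)

Require Import Defs.
From mathcomp Require Import all_boot all_order all_algebra.
From mathcomp Require Import complex.
From mathcomp Require Import all_classical all_reals.
From mathcomp Require Import ereal topology normedtype sequences measure numfun realfun.
From mathcomp Require Import measurable_realfun lebesgue_measure lebesgue_integral.
From mathcomp Require Import ring lra.

Set Implicit Arguments.
Unset Strict Implicit.
Unset Printing Implicit Defensive.

Import Order.TTheory GRing.Theory Num.Theory.
Import numFieldNormedType.Exports.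

Local Open Scope classical_set_scope.
Local Open Scope ring_scope.

(** * Timelike lines and achronal sets *)

Section euclidean_norm.
Context {R : realType}.
Implicit Types (v w : 'rV[R]_3) (t : R).

Definition enorm v : R := Num.sqrt (\sum_(i < 3) v ord0 i ^+ 2).

Lemma enorm_ge0 v : 0 <= enorm v.
Proof. exact: sqrtr_ge0. Qed.

Lemma sqr_enorm v : enorm v ^+ 2 = \sum_(i < 3) v ord0 i ^+ 2.
Proof. by rewrite sqr_sqrtr// sumr_ge0// => i _; exact: sqr_ge0. Qed.

Lemma enorm0 : enorm 0 = 0.
Proof. by rewrite /enorm big1 ?sqrtr0// => i _; rewrite mxE expr0n. Qed.

Lemma enormZ t v : enorm (t *: v) = `|t| * enorm v.
Proof.
rewrite /enorm -[`|t|]sqrtr_sqr.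
rewrite -sqrtrM ?sqr_ge0// mulr_sumr.
by congr Num.sqrt; apply: eq_bigr => i _; rewrite mxE exprMn.
Qed.

Lemma enormN v : enorm (- v) = enorm v.
Proof. by rewrite -scaleN1r enormZ normrN1 mul1r. Qed.

Lemma edot_le v w : \sum_(i < 3) v ord0 i * w ord0 i <= enorm v * enorm w.
Proof.
apply: le_trans (ler_norm _) _.
rewrite -sqrtr_sqr /enorm -sqrtrM; last by rewrite sumr_ge0// => i _; exact: sqr_ge0.
rewrite ler_wsqrtr// !big_ord_recl !big_ord0.
have CS (a b c d e f : R) : (a * d + (b * e + (c * f + 0))) ^+ 2 <=
    (a ^+ 2 + (b ^+ 2 + (c ^+ 2 + 0))) * (d ^+ 2 + (e ^+ 2 + (f ^+ 2 + 0))).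
  (* Lagrange's identity: the defect in Cauchy-Schwarz is the squared norm of the cross product. *)
  rewrite -subr_ge0 [leRHS](_ : _ =
    (a * e - b * d) ^+ 2 + (a * f - c * d) ^+ 2 + (b * f - c * e) ^+ 2); last by ring.
  by rewrite !addr_ge0// sqr_ge0.
exact: CS.
Qed.

Lemma enormD v w : enorm (v + w) <= enorm v + enorm w.
Proof.
rewrite -(@ler_pXn2r _ 2)// ?nnegrE ?addr_ge0 ?enorm_ge0//.
rewrite sqrrD !sqr_enorm.
have := edot_le v w.
rewrite -(ler_pM2l (ltr0Sn R 1)).
have -> : \sum_(i < 3) (v + w) ord0 i ^+ 2 = 2 * \sum_(i < 3) v ord0 i * w ord0 i +
  \sum_(i < 3) v ord0 i ^+ 2 + \sum_(i < 3) w ord0 i ^+ 2.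
  rewrite mulr_sumr -!big_split/=; apply: eq_bigr => i _; rewrite mxE; ring.
move: (\sum_(i < 3) _) (\sum_(i < 3) _) (\sum_(i < 3) _) => *; lra.
Qed.

Lemma continuous_enorm : continuous enorm.
Proof.
move=> v; apply: (continuous_comp (f := fun v => \sum_(i < 3) v ord0 i ^+ 2)).
  apply: (@cvg_big R _ _ _ _ (@add_continuous R) _ (nbhs v)) => i _.
  apply: (continuous_comp (f := fun v : 'rV[R]_3 => v ord0 i) (g := fun x => x ^+ 2)).
    exact: coord_continuous.
  exact: exprn_continuous.
exact: sqrt_continuous.
Qed.

End euclidean_norm.

(** * Chronological order, achronal sets and their encounters with timelike lines *)

Section chronology.
Context {R : realType}.
Local Notation E4 := (minkowski R).
Local Notation lines := (timelike_lines R).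
Implicit Types (x y z : E4) (u : lines) (s t : R) (M D U : set E4).

(* [chron x y]: y lies in the open forward light cone of x. *)
Definition chron x y : Prop := enorm (y.2 - x.2) < y.1 - x.1.

Lemma chron_trans y x z : chron x y -> chron y z -> chron x z.
Proof.
rewrite /chron => xy yz.
have := enormD (z.2 - y.2) (y.2 - x.2); rewrite addrA subrK; lra.
Qed.

Lemma chron_irr x : ~ chron x x.
Proof. by rewrite /chron !subrr enorm0 ltxx. Qed.

Lemma msquareBE x y :
  msquare (x - y) = (x.1 - y.1) ^+ 2 - enorm (x.2 - y.2) ^+ 2.
Proof. by rewrite sqr_enorm /msquare /mdot/= -expr2; congr (_ - _); apply: eq_bigr. Qed.

(** With e the spatial distance and d the time difference, the square is d^2 - e^2 = (d - e)(d + e).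
    As e >= 0, it is positive exactly when d > e or -d > e. This turns achronality and orthogonality
    into statements about the transitive relation [chron]. *)
Lemma msquare_gt0 x y : 0 < msquare (x - y) <-> chron x y \/ chron y x.
Proof.
rewrite msquareBE subr_gt0 /chron -[x.2 - y.2]opprB enormN.
have n0 := enorm_ge0 (y.2 - x.2); move: n0; set e := enorm _ => n0.
rewrite -subr_gt0 subr_sqr.
split=> [|[h|h]]; last 2 first.
- by rewrite nmulr_rgt0; lra.
- by rewrite pmulr_rgt0; lra.
have [h _|h] := ltP e (x.1 - y.1); first by right.
have [h' _|h' /lt_geF <-] := ltP e (y.1 - x.1); first by left.
by rewrite mulr_le0_ge0; lra.
Qed.

Lemma achronalP D : achronal D <-> forall x y, D x -> D y -> ~ chron x y.
Proof.
split=> [aD x y Dx Dy xy|h x y Dx Dy].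
  by have := aD _ _ Dx Dy; rewrite leNgt => /negP; apply; apply/msquare_gt0; left.
by rewrite leNgt; apply/negP => /msquare_gt0[]; exact: h.
Qed.

Lemma perpP x y : perp x y <-> [/\ x <> y, ~ chron x y & ~ chron y x].
Proof.
rewrite /perp leNgt; split=> [[xy /negP h]|[xy h h']].
  by split=> // ?; apply: h; apply/msquare_gt0; [left|right].
by split=> //; apply/negP => /msquare_gt0[].
Qed.

Definition lpt u t : E4 := (t, u.1 + t *: \val u.2).

Lemma lpt_chron u s t : s < t -> chron (lpt u s) (lpt u t).
Proof.
move=> st; rewrite /chron /= opprD addrACA subrr add0r -scalerBl enormZ.
have v1 : enorm (\val u.2) < 1 by have := valP u.2; rewrite inE.
by rewrite gtr0_norm ?subr_gt0// gtr_pMr ?subr_gt0.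
Qed.

Lemma lines_meetingE M : lines_meeting M = [set u | exists t, M (lpt u t)].
Proof.
apply/seteqP; split=> u /=.
  by move=> [_ [[t _ <-] Mx]]; exists t.
by move=> [t Mt]; exists (lpt u t); split=> //; exists t.
Qed.

Lemma lines_meeting0 : lines_meeting (set0 : set E4) = set0.
Proof. by rewrite lines_meetingE; apply/seteqP; split=> u //= [t]. Qed.

Lemma lines_meeting_bigcup (F : nat -> set E4) :
  lines_meeting (\bigcup_n F n) = \bigcup_n lines_meeting (F n).
Proof.
apply/seteqP; split=> u; rewrite lines_meetingE.
  by move=> [t [n _ Ft]]; exists n => //; rewrite lines_meetingE; exists t.
by move=> [n _]; rewrite lines_meetingE => -[t Ft]; exists t, n.
Qed.

(** The line moves away from y in space at speed below 1, so t is taken with t (1 - |v|) larger than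
    the initial spatial distance plus the time of y in absolute value. In [line_meets] this makes
    both the past and the future set of times nonempty. *)
Lemma lpt_reach u y : exists2 t, chron y (lpt u t) & chron (lpt u (- t)) y.
Proof.
have v1 : 0 < 1 - enorm (\val u.2) by have := valP u.2; rewrite inE subr_gt0.
pose a := enorm (u.1 - y.2) + `|y.1| + 1.
have a0 : 0 < a by rewrite /a; have := enorm_ge0 (u.1 - y.2); have := normr_ge0 y.1; lra.
exists (a / (1 - enorm (\val u.2))); set t := _ / _.
all: have t0 : 0 <= t by rewrite divr_ge0 ?ltW.
all: have ta : t - t * enorm (\val u.2) = a by rewrite /t; field; rewrite gt_eqF.
all: have := ler_norm y.1; have := ler_norm (- y.1); rewrite normrN.
all: rewrite /chron /=; move: ta; rewrite /a.
- have := enormD (u.1 - y.2) (t *: \val u.2).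
  by rewrite enormZ ger0_norm// addrAC; lra.
- have := enormD (y.2 - u.1) (t *: \val u.2).
  rewrite enormZ ger0_norm// scaleNr opprD opprK addrA -[y.2 - u.1]opprB enormN; lra.
Qed.

Lemma continuous_lpt u : continuous (lpt u).
Proof.
move=> t; apply: (@cvg_pair _ _ _ (nbhs t) (nbhs t) (nbhs (u.1 + t *: \val u.2)) _ _ _ idfun).
  exact: cvg_id.
by apply: cvgD; [exact: cvg_cst|apply: cvgZr_tmp; exact: cvg_id].
Qed.

Lemma open_chron_l y : open [set x | chron x y].
Proof.
have -> : [set x | chron x y] = (fun x : E4 => y.1 - x.1 - enorm (y.2 - x.2)) @^-1` [set r | 0 < r].
  by apply/seteqP; split=> x; rewrite /= subr_gt0.
apply: open_comp; last exact: open_gt.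
move=> x _; apply: cvgB; first by apply: cvgB; [exact: cvg_cst|exact: cvg_fst].
apply: (continuous_comp (f := fun x : E4 => y.2 - x.2)); last exact: continuous_enorm.
by apply: cvgB; [exact: cvg_cst|exact: cvg_snd].
Qed.

Lemma open_chron_r y : open [set x | chron y x].
Proof.
have -> : [set x | chron y x] = (fun x : E4 => x.1 - y.1 - enorm (x.2 - y.2)) @^-1` [set r | 0 < r].
  by apply/seteqP; split=> x; rewrite /= subr_gt0.
apply: open_comp; last exact: open_gt.
move=> x _; apply: cvgB; first by apply: cvgB; [exact: cvg_fst|exact: cvg_cst].
apply: (continuous_comp (f := fun x : E4 => x.2 - y.2)); last exact: continuous_enorm.
by apply: cvgB; [exact: cvg_snd|exact: cvg_cst].
Qed.

(* Otherwise the times at which the line is in the past, respectively in the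
   future, of a point of U would disconnect R. *)
Lemma line_meets U :
  (forall x, ~ U x -> exists2 y, U y & chron x y \/ chron y x) ->
  (forall x y z, U y -> U z -> chron y x -> chron x z -> U x) ->
  forall u, exists t, U (lpt u t).
Proof.
move=> Ucover Uconv u; apply: contrapT => /forallNP nU.
pose P := [set t | exists2 y, U y & chron (lpt u t) y].
pose F := [set t | exists2 y, U y & chron y (lpt u t)].
have oP : open P.
  have -> : P = \bigcup_(y in U) (lpt u @^-1` [set x | chron x y]).
    by apply/seteqP; split=> t [y Uy ty]; exists y.
  apply: bigcup_open => y _; apply: open_comp; last exact: open_chron_l.
  by move=> t _; exact: continuous_lpt.
have oF : open F.
  have -> : F = \bigcup_(y in U) (lpt u @^-1` [set x | chron y x]).
    by apply/seteqP; split=> t [y Uy ty]; exists y.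
  apply: bigcup_open => y _; apply: open_comp; last exact: open_chron_r.
  by move=> t _; exact: continuous_lpt.
have PF t : ~ (P t /\ F t).
  by move=> [[z Uz tz] [y Uy yt]]; apply: (nU t); exact: Uconv yt tz.
have cPF t : P t \/ F t.
  by have [y Uy [ty|yt]] := Ucover _ (nU t); [left|right]; exists y.
have [y Uy] : exists y, U y by have [y Uy _] := Ucover _ (nU 0); exists y.
have [t yt ty] := lpt_reach u y.
have PE : P = ~` F.
  apply/seteqP; split=> s; first by move=> Ps Fs; exact: (PF s).
  by move=> nFs; have [|/nFs] := cPF s.
have cR : connected [set: R] by apply/connected_intervalP.
have /seteqP[_] : P = setT.
  apply: cR.
  - by exists (- t), y.
  - by exists P => //; rewrite setTI.
  - by exists P; rewrite ?setTI// PE; exact: open_closedC.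
by move=> /(_ t I) Pt; apply: (PF t); split=> //; exists y.
Qed.

(** Both hypotheses of [line_meets] hold: a point outside D that is chronologically unrelated to D
    could be added to D, against maximality, and the convexity condition is vacuous because its
    premises relate two points of D. *)
Lemma maximal_achronal_meets D : maximal_achronal D -> forall u, exists t, D (lpt u t).
Proof.
move=> [/achronalP aD mD]; apply: line_meets; last first.
  by move=> x y z Dy Dz yx xz; have := aD _ _ Dy Dz (chron_trans yx xz).
move=> x nDx; apply: contrapT => nxy; apply: nDx.
rewrite -(mD (D `|` [set x])); first by right.
  apply/achronalP => y z [Dy|->] [Dz|->].
  - exact: aD.
  - by move=> yx; apply: nxy; exists y => //; right.
  - by move=> xz; apply: nxy; exists z => //; left.
  - exact: chron_irr.
by left.
Qed.

Lemma achronal_meets_once D u s t :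
  achronal D -> D (lpt u s) -> D (lpt u t) -> s = t.
Proof.
move=> /achronalP aD Ds Dt.
by case: (ltgtP s t) => // /(lpt_chron u) h; have := aD _ _ _ _ h; case.
Qed.

Lemma achronal_extend D : achronal D ->
  exists2 L, D `<=` L & maximal_achronal L.
Proof.
move=> aD.
(* The chains of Zorn's lemma include the empty one, with union [set0]; requiring [D]|[A] to be
   achronal, rather than A to contain D, lets [set0] qualify. *)
have [|A [aA mA]] := @Zorn_bigcup E4 [set A | achronal (D `|` A)].
  move=> F aF tF; apply/achronalP => x y.
  have aFD A : F A -> forall x y, (D `|` A) x -> (D `|` A) y -> ~ chron x y.
    by move=> /aF /achronalP.
  have /achronalP aD' := aD.
  move=> [Dx|[A FA Ax]] [Dy|[B FB By]].
  - exact: aD'.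
  - by apply: (aFD _ FB); [left|right].
  - by apply: (aFD _ FA); [right|left].
  - have [AB|BA] := tF _ _ FA FB.
      by apply: (aFD _ FB); right => //; exact: AB.
    by apply: (aFD _ FA); right => //; exact: BA.
exists (D `|` A); first exact: subsetUl.
split=> // D' aD' DAD'; apply/seteqP; split=> //.
apply: contrapT => nD'; apply: (mA D').
  split; first by move=> x Ax; apply: DAD'; right.
  by move=> D'A; apply: nD' => x /D'A; right.
rewrite /= (_ : D `|` D' = D')//; apply/setUidPr => x Dx.
by apply: DAD'; left.
Qed.

(** A point w of [perp_compl M] equal to z or in its future lies in the future of x, and one in the
    past of z lies in the past of y; both are excluded. *)
Lemma perp_closure_convex M x y z : perp_closure M x -> perp_closure M y ->
  chron x z -> chron z y -> perp_closure M z.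
Proof.
move=> cx cy xz zy w Mw.
have /perpP[_ nxw _] := cx w Mw; have /perpP[_ _ nwy] := cy w Mw.
apply/perpP; split.
- by move=> zw; apply: nxw; rewrite -zw.
- by move=> zw; apply: nxw; exact: chron_trans zw.
- by move=> wz; apply: nwy; exact: chron_trans zy.
Qed.

Lemma causal_logic_convex M x y z : causal_logic M -> M x -> M y ->
  chron x z -> chron z y -> M z.
Proof. by move=> [_ ->]; exact: perp_closure_convex. Qed.

Lemma orthogonal_sets_lines M N : orthogonal_sets M N ->
  lines_meeting M `&` lines_meeting N = set0.
Proof.
move=> MN; apply/seteqP; split=> u //; rewrite !lines_meetingE => -[/= [s Ms] [t Nt]].
have /perpP[nst lst lts] := MN _ _ Ms Nt.
case: (ltgtP s t) => [/(lpt_chron u)//|/(lpt_chron u)//|st].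
by apply: nst; rewrite st.
Qed.

Lemma achronal_sets_lines D D' : achronal (D `|` D') -> D `&` D' = set0 ->
  lines_meeting D `&` lines_meeting D' = set0.
Proof.
move=> aD DD'; apply/seteqP; split=> u //; rewrite !lines_meetingE => -[/= [s Ds] [t Dt]].
have st : s = t by apply: (achronal_meets_once (u := u) aD); [left|right].
by rewrite -[False]/(set0 (lpt u t)) -DD'; split=> //; rewrite -st.
Qed.

(** The union satisfies the hypotheses of [line_meets]. Its complement [perp_compl] is empty, since
    no point is orthogonal to itself, so every point outside the union is chronologically related to
    a point of it. Two points of the union with a third between them are chronologically related,
    hence lie in the same M n, which is convex. *)
Lemma causal_logic_cover (M : nat -> set E4) :
  (forall n, causal_logic (M n)) ->
  (forall n k, n <> k -> orthogonal_sets (M n) (M k)) ->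
  perp_closure (\bigcup_n M n) = setT ->
  \bigcup_n lines_meeting (M n) = setT.
Proof.
move=> cM oM MT; rewrite -lines_meeting_bigcup lines_meetingE.
apply/seteqP; split=> u // _ /=; apply: line_meets => [x nMx|x y z].
  have : ~ perp_compl (\bigcup_n M n) x.
    move=> Mx; have : perp_closure (\bigcup_n M n) x by rewrite MT.
    by move=> /(_ _ Mx) [].
  move=> /existsNP[y] /not_implyP[My]; rewrite perpP => nxy.
  exists y => //; apply: contrapT => /not_orP[n1 n2]; apply: nxy; split=> // xy.
  by apply: nMx; rewrite xy.
move=> [n _ My] [k _ Mz] yx xz.
have nk : n = k.
  apply: contrapT => /oM /(_ _ _ My Mz)/perpP[_ + _]; apply; exact: chron_trans xz.
by exists n => //; apply: (causal_logic_convex (cM n) My _ yx xz); rewrite nk.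
Qed.

(** * Borel measurability of the set of lines meeting a given set *)

Lemma borel_preimage (X Y : topologicalType) (f : X -> Y) (B : set Y) :
  continuous f -> <<s @open Y >> B -> <<s @open X >> (f @^-1` B).
Proof.
move=> /continuousP cf; move: B.
apply: (@smallest_sub _ _ (@open Y) [set B | <<s @open X >> (f @^-1` B)]).
  split=> /=.
  - by rewrite preimage_set0; exact: sigma_algebra0.
  - by move=> A fA; rewrite setTD preimage_setC -setTD; exact: sigma_algebraCD.
  - by move=> F fF; rewrite preimage_bigcup; exact: sigma_algebra_bigcup.
by move=> B /cf oB; exact: sub_sigma_algebra.
Qed.

Lemma continuous_velocity : continuous (fun u : lines => \val u.2).
Proof.
move=> u; apply: (continuous_comp (f := fun u : lines => u.2) (g := val)).
  exact: cvg_snd.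
exact: initial_continuous.
Qed.

Lemma continuous_lpt_comp (tau : lines -> R) : continuous tau ->
  continuous (fun u => lpt u (tau u)).
Proof.
move=> ctau u.
apply: (@cvg_pair _ _ _ (nbhs u) (nbhs (tau u)) (nbhs (u.1 + tau u *: \val u.2)) _ _ _ tau).
  exact: ctau.
apply: cvgD; first exact: cvg_fst.
by apply: cvgZ; [exact: ctau|exact: continuous_velocity].
Qed.

Lemma continuous_hitting_time D (tau : lines -> R) : achronal D ->
  (forall u, D (lpt u (tau u))) -> continuous tau.
Proof.
move=> /achronalP aD Dtau u.
have cl s : continuous (fun u => lpt u s).
  by apply: (continuous_lpt_comp (tau := cst s)); exact: cst_continuous.
have lt_tau s v : tau v < s -> \forall w \near v, tau w < s.
  move=> vs; have o : open (lpt^~ s @^-1` [set x | chron (lpt v (tau v)) x]).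
    by apply: open_comp => [w _|]; [exact: cl|exact: open_chron_r].
  apply: filterS (open_nbhs_nbhs (conj o (lpt_chron v vs))) => w /= vw.
  rewrite ltNge le_eqVlt; apply/negP => /orP[/eqP sw|].
    by apply: (aD _ _ (Dtau v) (Dtau w)); rewrite -sw.
  by move=> /(lpt_chron w) sw; apply: (aD _ _ (Dtau v) (Dtau w)); exact: chron_trans sw.
have gt_tau s v : s < tau v -> \forall w \near v, s < tau w.
  move=> vs; have o : open (lpt^~ s @^-1` [set x | chron x (lpt v (tau v))]).
    by apply: open_comp => [w _|]; [exact: cl|exact: open_chron_l].
  apply: filterS (open_nbhs_nbhs (conj o (lpt_chron v vs))) => w /= vw.
  rewrite ltNge le_eqVlt; apply/negP => /orP[/eqP sw|].
    by apply: (aD _ _ (Dtau w) (Dtau v)); rewrite sw.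
  by move=> /(lpt_chron w) sw; apply: (aD _ _ (Dtau w) (Dtau v)); exact: chron_trans vw.
apply/cvgrPdist_lt => e e0.
have h1 : tau u < tau u + e by rewrite ltrDl.
have h2 : tau u - e < tau u by rewrite ltrBlDr ltrDl.
apply: filterS2 (lt_tau _ _ h1) (gt_tau _ _ h2) => w; rewrite ltr_norml => a b.
by apply/andP; split; lra.
Qed.

Lemma measurable_lines_achronal D : borel_achronal D ->
  <<s @open lines >> (lines_meeting D).
Proof.
move=> [bD /achronal_extend[L DL mL]].
have aL : achronal L by case: mL.
have /choice[tau tauL] := maximal_achronal_meets mL.
rewrite (_ : lines_meeting D = (fun u => lpt u (tau u)) @^-1` D).
  apply: borel_preimage bD; apply: continuous_lpt_comp.
  exact: continuous_hitting_time aL tauL.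
rewrite lines_meetingE; apply/seteqP; split=> u /=; last by exists (tau u).
by move=> [t Dt]; rewrite (achronal_meets_once aL (tauL u) (DL _ Dt)).
Qed.

Let e0 n : E4 := (n.+1%:R^-1, 0).

Let chronD n x : chron x (x + e0 n).
Proof.
by rewrite /chron /= ![x.2 + _]addrC ![x.1 + _]addrC !addrK enorm0 invr_gt0 ltr0n.
Qed.

Let chronDr x y : chron x y -> exists n, chron (x + e0 n) y.
Proof.
rewrite /chron ltrBrDl => /ltr_add_invr[n nxy]; exists n.
change (enorm (y.2 - (x.2 + 0)) < y.1 - (x.1 + n.+1%:R^-1)).
rewrite addr0; move: nxy.
by move: (enorm _) (_^-1) (x.1) (y.1) => *; lra.
Qed.

(* Either the line stays in M for an interval of times, and hence meets it at a
   rational one, or it meets the achronal set of those points of M without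
   points of M in their future. *)
Lemma measurable_lines_convex M : borel_set M ->
  (forall x y z, M x -> M y -> chron x z -> chron z y -> M z) ->
  <<s @open lines >> (lines_meeting M).
Proof.
move=> bM cM.
have ctr a : continuous (fun x : E4 => x + a).
  by move=> x; apply: cvgD; [exact: cvg_id|exact: cvg_cst].
(* The points that have a point of M straight above them at one of the heights 1/(n+1). By [chronDr]
   and convexity a point of M with any point of M in its future is of this kind, and the countable
   union keeps N Borel. *)
pose N := \bigcup_n (fun x : E4 => x + e0 n) @^-1` M.
have bM0 : borel_set (M `\` N).
  have := @measurableD _ (g_sigma_algebraType (@open E4)) M N; apply=> //.
  by apply: bigcupT_measurable => n; exact: borel_preimage bM.
have aM0 : achronal (M `\` N).
  apply/achronalP => x y [Mx nNx] [My nNy] /chronDr[n nxy].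
  by apply: nNx; exists n => //; exact: cM Mx My _ nxy.
rewrite (_ : lines_meeting M =
    (\bigcup_(q : rat) (fun u => lpt u (ratr q)) @^-1` M) `|` lines_meeting (M `\` N)).
  have := @measurableU _ (g_sigma_algebraType (@open lines)); apply.
    apply: (@bigcupT_measurable_rat _ (g_sigma_algebraType (@open lines))) => q.
    by apply: borel_preimage bM; apply: (continuous_lpt_comp (tau := cst (ratr q)));
      exact: cst_continuous.
  exact: measurable_lines_achronal.
rewrite !lines_meetingE; apply/seteqP; split=> u /=; last first.
  by move=> [[q _ Mq]|[t [Mt _]]]; [exists (ratr q)|exists t].
move=> [t Mt]; have [[n _ Nt]|nN] := pselect (N (lpt u t)); last by right; exists t.
have stay (A : set E4) : open A -> A (lpt u t) ->
    exists2 e : R, 0 < e & forall s, `|t - s| < e -> A (lpt u s).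
  move=> oA At; have : nbhs (lpt u t) A by exact: open_nbhs_nbhs.
  by move=> /(@continuous_lpt u t)/nbhs_ballP[e /= e_gt0 eA]; exists e => // s ts; exact: eA.
(* Shortly after t the line is still in the past of the point [lpt u t + e0 n] of M, so convexity
   puts it in M at a rational time. *)
left; have [e e_gt0 eA] := stay _ (@open_chron_l (lpt u t + e0 n : E4)) (chronD _ _).
have /rat_in_itvoo[q] : t < t + e by rewrite ltrDl.
rewrite in_itv /= => /andP[tq qt]; exists q => //=.
apply: cM Mt Nt (lpt_chron u tq) _; apply: eA.
by rewrite ltr_norml; apply/andP; split; lra.
Qed.

Lemma measurable_lines_causal_logic M : causal_logic M ->
  <<s @open lines >> (lines_meeting M).
Proof.
move=> cM; apply: measurable_lines_convex; first by case: cM.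
by move=> x y z Mx My; exact: causal_logic_convex cM Mx My.
Qed.

End chronology.

(** * Square-integrable functions and multiplication by indicators *)

Section prehilbert_topology.
Context {R : realType} {H : preHilbertType R}.
Implicit Types x y z : H.

Lemma gt0_complexE (e : R[i]) : 0 < e -> (0 < complex.Re e) /\ e = (complex.Re e)%:C%C.
Proof. by case: e => a b; rewrite ltcE /= => /andP[/eqP -> a0]. Qed.

Lemma rnormD_le x y : rnorm (x + y) <= rnorm x + rnorm y.
Proof. by have := ler_normD x y; rewrite !rnormE -rmorphD lecR. Qed.

Lemma rnorm0 : rnorm (0 : H) = 0.
Proof. by rewrite /rnorm normr0. Qed.

Lemma rnormB_sym x y : rnorm (x - y) = rnorm (y - x).
Proof. by rewrite -rnormN opprB. Qed.

Lemma ball_rnormE x (e : R[i]) : 0 < e -> ball x e = [set y | rnorm (x - y) < complex.Re e].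
Proof.
move=> /gt0_complexE[_ ->]; rewrite -ball_normE.
by apply/seteqP; split=> y; rewrite /= rnormE ltcR.
Qed.

Lemma cvg_rnorm0 {I : Type} {F : set_system I} {FF : Filter F} (f : I -> H) (l : H) :
  rnorm (f i - l) @[i --> F] --> 0 -> f @ F --> l.
Proof.
move=> fl; apply/cvgrPdist_lt => e /gt0_complexE[e0 ->].
move/cvgrPdist_lt : fl => /(_ _ e0); apply: filterS => i.
by rewrite sub0r normrN ger0_norm ?rnorm_ge0// rnormB_sym rnormE ltcR.
Qed.

Lemma cvg_rnormB {I : Type} {F : set_system I} {FF : Filter F} (f : I -> H) (l : H) :
  f @ F --> l -> rnorm (f i - l) @[i --> F] --> 0.
Proof.
move=> fl; apply/cvgrPdist_lt => e e0.
have e0' : 0 < e%:C%C by rewrite ltcR.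
move/cvgrPdist_lt : fl => /(_ _ e0'); apply: filterS => i.
by rewrite sub0r normrN ger0_norm ?rnorm_ge0// rnormB_sym rnormE ltcR.
Qed.

Lemma rnorm_dot x : rnorm x ^+ 2 = complex.Re (dot x x).
Proof. by rewrite dotxx. Qed.

Lemma rnorm_pythagoras x y : dot x y = 0 ->
  rnorm (x + y) ^+ 2 = rnorm x ^+ 2 + rnorm y ^+ 2.
Proof. by move=> xy; rewrite rnormD2 xy mulr0 addr0. Qed.

Lemma dot_self_ge0 x : 0 <= dot x x.
Proof. by rewrite dotxx lecR sqr_ge0. Qed.

(** Boundedness is automatic: A x and x - A x are orthogonal, so Pythagoras gives the bound 1. *)
Lemma orthogonal_projectionP (A : H -> H) : linear A ->
  (forall x, A (A x) = A x) -> (forall x y, dot (A x) y = dot x (A y)) ->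
  orthogonal_projection A.
Proof.
move=> lA AA dA; split=> //; split=> //; exists 1 => x; rewrite mul1r !rnormE lecR.
rewrite -(@ler_pXn2r _ 2)// ?nnegrE ?rnorm_ge0//.
have -> : rnorm x ^+ 2 = rnorm (A x) ^+ 2 + rnorm (x - A x) ^+ 2.
  rewrite -rnorm_pythagoras ?subrKC//.
  rewrite dotDr -scaleN1r dotZr rmorphN rmorph1 mulN1r.
  by rewrite -(dA (A x) x) AA subrr.
by rewrite lerDl sqr_ge0.
Qed.

Lemma orthogonal_projection_ge0 (A : H -> H) :
  orthogonal_projection A -> nonnegative_operator A.
Proof. by move=> [_ AA dA] x; rewrite -AA dA dot_self_ge0. Qed.

End prehilbert_topology.

Section L2_norm.
Context {R : realType} {H : preHilbertType R} d {T : measurableType d}.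
Variables (mu : {measure set T -> \bar R}) (hH : separable_hilbert H).
Local Notation L2 := (L2 mu hH).
Local Notation sepH := (hilbert_separable hH).
Implicit Types u v w : L2.

Lemma L2_rnorm u : rnorm u ^+ 2 = \int[mu]_x rnorm (u x) ^+ 2.
Proof.
by rewrite rnorm_dot; apply: eq_Rintegral => x _; rewrite rnorm_dot.
Qed.

Lemma L2_rnormE u : (rnorm u ^+ 2)%:E = (\int[mu]_x (rnorm (u x) ^+ 2)%:E)%E.
Proof.
rewrite L2_rnorm /Rintegral fineK// ge0_fin_numE; first by case: (L2_sq u).
by apply: integral_ge0 => x _; rewrite lee_fin sqr_ge0.
Qed.

Lemma measurable_Redot (f g : T -> H) : borel_fun f -> borel_fun g ->
  measurable_fun setT (EFin \o (fun x => complex.Re (dot (f x) (g x)))).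
Proof. by move=> bf bg; apply/measurable_EFinP; exact: borel_fun_Redot sepH _ _ bf bg. Qed.

Lemma L2_dot_ae u v u' v' :
  {ae mu, forall x, dot (u x) (v x) = dot (u' x) (v' x)} -> dot u v = dot u' v'.
Proof.
move=> e; congr Complex; congr fine.
  apply: ae_eq_integral => //; [exact/measurable_Redot/L2_borel/L2_borel..|].
  by apply: filterS e => x /= ->.
(* The imaginary part is a real part after multiplication by -i, which reduces its measurability to
   [measurable_Redot]. *)
have E (f g : T -> H) : (fun x => (complex.Im (dot (f x) (g x)))%:E) =
    (fun x => (complex.Re (dot ((- 'i) *: f x) (g x)))%:E).
  by apply/funext => x; rewrite Im_dot !dotZl mulNr; case: (_ * _).
rewrite !E; apply: ae_eq_integral => //.
1,2: by apply: measurable_Redot; [apply: borel_funZ; [exact: sepH|]|]; exact: L2_borel.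
by apply: filterS e => x; rewrite !dotZl => ->.
Qed.

Lemma L2_subE u v : {ae mu, forall x, (u - v : L2) x = u x - v x}.
Proof.
rewrite -scaleN1r; apply: filterS2 (L2_addE u (-1 *: v)) (L2_scaleE (-1) v) => x -> ->.
by rewrite scaleN1r.
Qed.

(** Dominated convergence for the squared distances, followed by a square root. Strong convergence
    of the operators, completeness and separability all go through this form. *)
Lemma cvg_L2_dominated (f : nat -> L2) (g : L2) (h : T -> \bar R) :
  mu.-integrable setT h ->
  (forall n, {ae mu, forall x, ((rnorm (f n x - g x) ^+ 2)%:E <= h x)%E}) ->
  {ae mu, forall x, rnorm (f n x - g x) @[n --> \oo] --> 0} ->
  f @ \oo --> g.
Proof.
move=> ih fh fg; apply: cvg_rnorm0.
have fgE n := L2_subE (f n) g.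
have [|||||_ c0 _] := @dominated_convergence _ T R mu setT measurableT
  (fun n x => (rnorm ((f n - g : L2) x) ^+ 2)%:E) (cst 0%E) h.
- by move=> n; exact: measurable_rnorm2 (L2_borel _).
- exact: measurable_cst.
- apply: filterS2 fg (ae_foralln fgE) => x fgx e _.
  apply/fine_cvgP; split; first exact: nearW.
  rewrite (_ : _ \o _ = (fun n => rnorm (f n x - g x) * rnorm (f n x - g x))).
    by rewrite -(mulr0 (0 : R)); exact: cvgM.
  by apply/funext => n /=; rewrite e expr2.
- exact: ih.
- apply: filterS2 (ae_foralln fh) (ae_foralln fgE) => x fhx e n _.
  by rewrite abse_EFin ger0_norm ?sqr_ge0// e.
move: c0 => /fine_cvgP[_].
rewrite (_ : _ \o _ = (fun n => rnorm (f n - g) ^+ 2)); last first.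
  apply/funext => n /=; rewrite L2_rnorm; congr fine; apply: eq_integral => x _.
  by rewrite subr0 ger0_norm// sqr_ge0.
move=> fg2; have := cvg_comp _ _ fg2 (@sqrt_continuous R (0 : R)); rewrite sqrtr0.
rewrite (_ : _ \o _ = (fun n => rnorm (f n - g)))//.
by apply/funext => n /=; rewrite sqrtr_sqr ger0_norm ?rnorm_ge0.
Qed.

End L2_norm.

(** * Projections given by indicator functions and their strong sums *)

Section indicator_operators.
Context {R : realType} {H : preHilbertType R} d {T : measurableType d}.
Variables (mu : {measure set T -> \bar R}) (hH : separable_hilbert H).
Local Notation E := (Ecan mu hH).
Implicit Types (A B : set T) (u v : L2 mu hH).

Lemma completion_measurable_measurable A : measurable A -> completion_measurable mu A.
Proof.
by move=> mA; exists A => //; exists set0; rewrite ?setU0//; exact: negligible_set0.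
Qed.

Lemma Ecan_projection A : completion_measurable mu A ->
  orthogonal_projection (E A).
Proof.
move=> cA; have EA u := EcanE u cA.
apply: orthogonal_projectionP => [a u v|u|u v].
- apply: L2_eq.
  apply: filterS (filterI (EA (a *: u + v)) (filterI (L2_addE (a *: u) v) (filterI (L2_scaleE a u) (filterI (L2_addE (a *: E A u) (E A v)) (filterI (L2_scaleE a (E A u)) (filterI (EA u) (EA v))))))) => x [-> [-> [-> [-> [-> [-> ->]]]]]].
  by rewrite scalerDr !scalerA mulrC.
- apply: L2_eq; apply: filterS2 (EA (E A u)) (EA u) => x -> ->.
  by rewrite scalerA indicE; case: (x \in A); rewrite ?mul1r ?mul0r.
- apply: L2_dot_ae; apply: filterS2 (EA u) (EA v) => x -> ->.
  by rewrite dotZl dotZr indicE rmorph_nat.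
Qed.

Lemma Ecan_set0 u : E set0 u = 0.
Proof.
apply: L2_eq; apply: filterS2 (EcanE u (completion_measurable_measurable measurable0)) (L2_zeroE mu hH) => x -> ->.
by rewrite indic0 scale0r.
Qed.

(** Each x lies in exactly one A k, so the n-th partial sum at x is 0 for n <= k and u x afterwards.
    The squared error is thus dominated by |u|^2 and eventually vanishes at x. *)
Lemma Ecan_series (A : nat -> set T) : (forall n, measurable (A n)) ->
  trivIset setT A -> \bigcup_n A n = setT ->
  forall u, series (fun n => E (A n) u) @ \oo --> u.
Proof.
move=> mA tA AT u.
have Ax x : exists2 k, A k x & forall n, \1_(A n) x = (n == k)%:R :> R[i].
  have [k _ Akx] : (\bigcup_n A n) x by rewrite AT.
  exists k => // n; rewrite indicE (_ : (x \in A n) = (n == k))//.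
  apply/idP/eqP => [|->]; last by rewrite inE.
  by rewrite inE => Anx; apply: tA => //; exists x.
have sE n : {ae mu, forall x, (series (fun n => E (A n) u) n : L2 mu hH) x =
    \sum_(0 <= i < n) (\1_(A i) x : R[i]) *: u x}.
  elim: n => [|n ih].
    by rewrite /series/= big_geq//; apply: filterS (L2_zeroE mu hH) => x ->; rewrite big_geq.
  rewrite seriesEnat /= big_nat_recr//=.
  have cA := completion_measurable_measurable (mA n).
  apply: filterS (filterI (L2_addE (series (fun n => E (A n) u) n) (E (A n) u)) (filterI (EcanE u cA) ih)) => x [-> [-> ->]].
  by rewrite big_nat_recr.
have sAx x k n : A k x -> (forall n, \1_(A n) x = (n == k)%:R :> R[i]) ->
    \sum_(0 <= i < n) (\1_(A i) x : R[i]) *: u x = if (k < n)%N then u x else 0.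
  move=> Akx Ak; elim: n => [|n ih]; first by rewrite big_geq.
  rewrite big_nat_recr//= ih Ak ltnS.
  by case: (ltngtP k n) => //= _; rewrite ?scale0r ?scale1r ?addr0 ?add0r.
have [_ iu] := (sq_integrableP mu u).1 (L2_sq u).
apply: (cvg_L2_dominated iu) => [n|].
  apply: filterS (sE n) => x ->; have [k Akx Ak] := Ax x; rewrite (sAx _ k)// lee_fin.
  by case: ifP; rewrite ?sub0r ?rnormN// subrr rnorm0 expr0n sqr_ge0.
apply: filterS (ae_foralln sE) => x xE; have [k Akx Ak] := Ax x.
apply: (cvg_near_cst (0 : R)).
by exists k.+1 => // n /= kn; rewrite xE (sAx _ k)// kn subrr rnorm0.
Qed.

End indicator_operators.

(** * Completeness of L2 *)

Section borel_limits.
Context {R : realType} {H : preHilbertType R} d {T : measurableType d}.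
Hypothesis sepH : separable H.

Lemma dense_sequence : exists c : nat -> H,
  forall x (e : R), 0 < e -> exists i, rnorm (x - c i) < e.
Proof.
have [D /countable_injP[g ginj] dD] := sepH.
(* The sequence inverts the injection g of D into the naturals; indices outside the image of D
   receive the filler 0. *)
exists (fun n => xget 0 [set x | D x /\ g x = n]) => x e e0.
have e0' : 0 < e%:C%C by rewrite ltcR.
have [y [xy Dy]] := dD (ball x e%:C%C) (ex_intro _ x (ballxx x e0')) (ball_open x e%:C%C).
exists (g y); case: xgetP => [z _ [Dz gzy]|/(_ y)]; last by case.
have -> : z = y by apply: ginj; rewrite ?inE.
by move: xy; rewrite ball_rnormE.
Qed.

(** Separability makes every open set a countable union of balls, whose preimages are sublevel sets
    of distance functions. Limits of H-valued functions are thereby handled through real-valued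
    ones. *)
Lemma borel_fun_dist (f : T -> H) :
  (forall c, measurable_fun setT (fun x => rnorm (f x - c))) -> borel_fun f.
Proof.
move=> mf; apply/borel_funP => U oU.
have [c cdense] := dense_sequence.
pose B i k := [set y | rnorm (y - c i) < k.+1%:R^-1].
have -> : f @^-1` U = \bigcup_i \bigcup_(k in [set k | B i k `<=` U]) f @^-1` B i k.
  apply/seteqP; split=> x /=; last by move=> [i _ [k /= BU] /BU].
  move=> Ufx; have : nbhs (f x) U by exact: open_nbhs_nbhs.
  move=> /nbhs_ballP[e /= e0]; rewrite ball_rnormE//.
  have [{}e0 _] := gt0_complexE e0 => eU.
  have [k] := ltr_add_invr e0; rewrite add0r => ke.
  (* The radius 1/(k'+1) is half of 1/(k+1), which leaves room for the triangle inequality. *)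
  pose k' := (k.*2.+1)%N.
  have k'E : k'.+1%:R^-1 = k.+1%:R^-1 / 2 :> R.
    by rewrite /k' -doubleS -muln2 natrM invfM mulrC.
  have [|i xi] := cdense (f x) k'.+1%:R^-1; first by rewrite invr_gt0.
  exists i => //; exists k' => //= y yi; apply: eU => /=.
  have := rnormD_le (f x - c i) (c i - y); rewrite addrA subrK [rnorm (c i - y)]rnormB_sym.
  move: yi xi ke; rewrite /B /= k'E; move: (k.+1%:R^-1) => p.
  by move: (rnorm _) (rnorm _) (rnorm _) (complex.Re e) => *; lra.
apply: bigcupT_measurable => i; apply: bigcup_measurable => k _.
have := mf (c i) measurableT `]-oo, k.+1%:R^-1[%classic; rewrite setTI => mfi.
have -> : f @^-1` B i k = (fun x => rnorm (f x - c i)) @^-1` `]-oo, k.+1%:R^-1[%classic.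
  by apply/seteqP; split=> x; rewrite /B /= in_itv.
by apply: mfi; exact: measurable_itv.
Qed.

Lemma borel_fun_lim (f : nat -> T -> H) (g : T -> H) :
  (forall n, borel_fun (f n)) -> (forall x, rnorm (f n x - g x) @[n --> \oo] --> 0) ->
  borel_fun g.
Proof.
move=> bf fg; apply: borel_fun_dist => c.
apply: (@measurable_fun_cvg _ _ _ setT (fun n x => rnorm (f n x - c))) => // [n|x _].
  apply: (borel_fun_rnorm (f := f n \+ cst (- c))); apply: borel_funD => //.
  exact: measurable_cst.
apply: continuous_cvg; first exact: continuous_rnorm.
by apply: cvgB; [exact: cvg_rnorm0|exact: cvg_cst].
Qed.

End borel_limits.

Section fast_cauchy.
Context {R : realType} {H : preHilbertType R}.
Hypothesis cH : forall F : set_system H, ProperFilter F -> cauchy F -> cvg F.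

Lemma fast_cauchy_cvg (v : nat -> H) (c : R) :
  (forall n, rnorm (v n.+1 - v n) <= c * 2^-1 ^+ n) ->
  exists l, forall n, rnorm (v n - l) <= 2 * c * 2^-1 ^+ n.
Proof.
move=> vc; have c0 : 0 <= c.
  by have := vc 0%N; rewrite expr0 mulr1; apply: le_trans; exact: rnorm_ge0.
(* The right-hand side is the exact partial geometric sum, which lets the induction on k close. *)
have vmn n k : rnorm (v n - v (n + k)%N) <= 2 * c * (2^-1 ^+ n - 2^-1 ^+ (n + k)).
  elim: k => [|k ih]; first by rewrite addn0 !subrr rnorm0 mulr0.
  have := rnormD_le (v n - v (n + k)%N) (v (n + k)%N - v (n + k).+1).
  rewrite addrA subrK addnS; move: (vc (n + k)%N); rewrite rnormB_sym exprS.
  by move: ih; move: (rnorm _) (rnorm _) (rnorm _) (_ ^+ (n + k)) (_ ^+ n) => *; lra.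
have p0 n : 0 <= (2^-1 : R) ^+ n by rewrite exprn_ge0.
have vmn' n k : rnorm (v n - v (n + k)%N) <= 2 * c * 2^-1 ^+ n.
  apply: le_trans (vmn n k) _; rewrite ler_wpM2l ?mulr_ge0// gerBl//.
have pcvg (e : R) : 0 < e -> exists n, 2 * c * 2^-1 ^+ n < e.
  move=> e0; have := @cvg_geometric R (2 * c) 2^-1.
  rewrite ger0_norm ?invr_ge0// invf_lt1// ltr1n => /(_ isT)/cvgr0Pnorm_lt/(_ _ e0)[N _ /(_ N (leqnn N))].
  by move=> /= h; exists N; apply: le_lt_trans h; exact: ler_norm.
have /cvg_ex[l vl] : cvg (v @ \oo).
  apply: cH; apply: cauchy_exP => e e0; have [{}e0' _] := gt0_complexE e0.
  have [n ne] := pcvg _ e0'; exists (v n); exists n => // m /= nm.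
  rewrite ball_rnormE//=; apply: le_lt_trans ne.
  by rewrite -(subnKC nm).
exists l => n; apply/ler_addgt0Pr => e e0.
have vl0 : rnorm (v i - l) @[i --> \oo] --> 0 by exact: cvg_rnormB.
move/cvgrPdist_lt : vl0 => /(_ _ e0)[N _ Ne].
have := Ne (n + N)%N (leq_addl _ _); rewrite /= sub0r normrN ger0_norm ?rnorm_ge0// => Nl.
have := rnormD_le (v n - v (n + N)%N) (v (n + N)%N - l); rewrite addrA subrK.
by have := vmn' n N; move: Nl => *; lra.
Qed.

End fast_cauchy.

Section L2_complete.
Context {R : realType} {H : preHilbertType R} d {T : measurableType d}.
Variables (mu : {measure set T -> \bar R}) (hH : separable_hilbert H).
Local Notation L2 := (L2 mu hH).

(* Integrating the series of 4^n |u_(n+1) - u_n|^2 shows that almost everywhere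
   |u_(n+1) - u_n| = O(2^-n). *)
Lemma L2_fast_cauchy_cvg (u : nat -> L2) :
  (forall n, rnorm (u n.+1 - u n) <= 4^-1 ^+ n.+1) -> exists l : L2, u @ \oo --> l.
Proof.
move=> uc; pose a n x := 4 ^+ n * rnorm ((u n.+1 - u n : L2) x) ^+ 2.
have a0 n x : 0 <= a n x by rewrite mulr_ge0 ?sqr_ge0// exprn_ge0.
pose S x := (\sum_(n <oo) (a n x)%:E)%E.
have S0 x : (0 <= S x)%E by apply: nneseries_ge0 => n _ _; rewrite lee_fin.
have ma n : measurable_fun setT (EFin \o a n).
  apply/measurable_EFinP; apply: measurable_funM => //.
  apply: measurable_funX; exact/borel_fun_rnorm/L2_borel.
have mS : measurable_fun setT S.
  refine (ge0_emeasurable_sum (h := fun n x => (a n x)%:E) (P := xpredT) _ _).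
    by move=> n x _ _; rewrite lee_fin.
  by move=> n _; exact: ma.
(* The squared distance is at most 16^-(n+1), which beats the weight 4^n; the bound is written in
   the shape of [epsilon_trick0], so that the integrals sum to at most 1. *)
have inta n : (\int[mu]_x (a n x)%:E <= (1 / (2 ^ n.+1)%:R)%:E)%E.
  under eq_integral do rewrite EFinM.
  rewrite ge0_integralZl_EFin// ?exprn_ge0//; last 2 first.
  - by move=> x _; rewrite lee_fin sqr_ge0.
  - exact: measurable_rnorm2 (L2_borel _).
  rewrite -L2_rnormE -EFinM lee_fin.
  have : rnorm (u n.+1 - u n) ^+ 2 <= (4^-1 ^+ n.+1) ^+ 2.
    by rewrite ler_pXn2r ?nnegrE ?rnorm_ge0 ?exprn_ge0.
  have q1 : 1 <= (2 : R) ^+ n by rewrite exprn_ege1// ler1n.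
  have f0 : 0 <= (4 : R) ^+ n by rewrite exprn_ge0.
  move=> /(ler_wpM2l f0)/le_trans; apply.
  rewrite natrX !exprS !exprVn (_ : (4 : R) = 2 ^+ 2); last by rewrite -natrX.
  rewrite -!exprM [(2 * n)%N]mulnC exprM; move: (2 ^+ n) q1 => q q1.
  rewrite [leLHS](_ : _ = (16 * q ^+ 2)^-1); last by field; rewrite gt_eqF; lra.
  by rewrite div1r lef_pV2 ?posrE; nra.
have iS : mu.-integrable setT S.
  apply/integrableP; split=> //; under eq_integral do rewrite gee0_abs//.
  rewrite integral_nneseries//; last by move=> n x _; rewrite lee_fin.
  apply: (@le_lt_trans _ _ 1%:E); last exact: ltry.
  apply: le_trans (epsilon_trick0 xpredT ler01).
  apply: lee_nneseries => // n _ _.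
  by apply: integral_ge0 => x _; rewrite lee_fin.
have [N [mN N0 subN]] : {ae mu, forall x, (S x \is a fin_num) /\
    (forall n, (u n.+1 - u n : L2) x = u n.+1 x - u n x)}.
  have Sfin := integrable_ae measurableT iS.
  have := ae_foralln (fun n => L2_subE (u n.+1) (u n)).
  by apply: filterS2 Sfin => x /(_ I).
have uN x : ~ N x -> exists l, forall n,
    rnorm (u n x - l) <= 2 * Num.sqrt (fine (S x)) * 2^-1 ^+ n.
  move=> nNx; have [Sfin dE] : (S x \is a fin_num) /\
      (forall n, (u n.+1 - u n : L2) x = u n.+1 x - u n x).
    by apply: contrapT => h; apply: nNx; exact: subN.
  apply: (fast_cauchy_cvg (hilbert_complete hH) (v := fun n => u n x)) => n; rewrite -dE.
  have aS : a n x <= fine (S x).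
    rewrite -lee_fin fineK//.
    have : ((a n x)%:E <= \sum_(0 <= i < n.+1) (a i x)%:E)%E.
      by rewrite big_nat_recr//= leeDr// sume_ge0// => i _; rewrite lee_fin.
    by move=> /le_trans; apply; apply: nneseries_lim_ge => i _ _; rewrite lee_fin.
  have := ler_wsqrtr aS; rewrite /a sqrtrM ?exprn_ge0// sqrtr_sqr ger0_norm ?rnorm_ge0//.
  have -> : (4 : R) = 2 ^+ 2 by rewrite -natrX.
  rewrite -exprM mulnC exprM sqrtr_sqr ger0_norm ?exprn_ge0// exprVn.
  by rewrite ler_pdivlMr ?exprn_gt0// mulrC.
have mNC : measurable (~` N) by exact: measurableC.
(* Cutting off the null set N makes the sequence converge at every point, so its limit g is Borel by
   [borel_fun_lim]. *)
pose f n x := (\1_(~` N) x : R[i]) *: u n x.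
have bf n : borel_fun (f n) by case: (sq_integrable_indic mNC (L2_sq (u n))).
have /choice[g fg] x : exists l, forall n,
    rnorm (f n x - l) <= 2 * Num.sqrt (fine (S x)) * 2^-1 ^+ n.
  have [Nx|nNx] := pselect (N x).
    exists 0 => n; rewrite /f indicE memNset//.
    by rewrite scale0r subrr rnorm0 !mulr_ge0 ?sqrtr_ge0 ?exprn_ge0.
  have [l ul] := uN _ nNx; exists l => n.
  by rewrite /f indicE mem_set// scale1r.
have p1 n : (2^-1 : R) ^+ n <= 1 by rewrite exprn_ile1// invf_le1// ler1n.
have fgS n x : rnorm (f n x - g x) <= 2 * Num.sqrt (fine (S x)).
  apply: le_trans (fg x n) _.
  by rewrite ler_piMr// mulr_ge0// sqrtr_ge0.
have fg0 x : rnorm (f n x - g x) @[n --> \oo] --> 0.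
  apply: (@squeeze_cvgr _ _ _ _ (cst 0) (geometric (2 * Num.sqrt (fine (S x))) 2^-1)).
  - by apply: nearW => n; rewrite rnorm_ge0/=; exact: fg.
  - exact: cvg_cst.
  - by apply: cvg_geometric; rewrite ger0_norm ?invr_ge0// invf_lt1// ltr1n.
have bg : borel_fun g by exact: borel_fun_lim (hilbert_separable hH) _ _ bf fg0.
pose h x := (4%:E * S x)%E.
have ih : mu.-integrable setT h by exact: integrableZl.
have fgh n x : ((rnorm (f n x - g x) ^+ 2)%:E <= h x)%E.
  have := S0 x; rewrite /h; have := fgS n x; case: (S x) => [s| |]//=; last first.
    by move=> _ _; rewrite mulry gtr0_sg// mul1e leey.
  rewrite lee_fin => fgs s0; rewrite -EFinM lee_fin.
  have -> : 4 * s = (2 * Num.sqrt s) ^+ 2 by rewrite exprMn sqr_sqrtr// -natrX.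
  by rewrite ler_pXn2r ?nnegrE ?rnorm_ge0// mulr_ge0 ?sqrtr_ge0.
(* From g = f 0 + (g - f 0) follows |g|^2 <= 2 (|f 0|^2 + h). *)
have sg : sq_integrable mu g.
  have [_ If] := (sq_integrableP mu (f 0%N)).1 (sq_integrable_indic mNC (L2_sq (u 0%N))).
  have I2 := integrableZl measurableT 2 (integrableD measurableT If ih).
  apply/sq_integrableP; split=> //.
  apply: le_integrable I2 => //; first exact: measurable_rnorm2.
  move=> x _; have := fgh 0%N x; have h0 : (0 <= h x)%E by rewrite mule_ge0.
  rewrite gee0_abs ?lee_fin ?sqr_ge0// gee0_abs; last first.
    by rewrite mule_ge0// adde_ge0// lee_fin sqr_ge0.
  case: (h x) h0 => [s| |]//; last by move=> _ _; rewrite addey// mulry gtr0_sg// mul1e leey.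
  rewrite !lee_fin => s0 fgs.
  change (rnorm (g x) ^+ 2 <= 2 * (rnorm (f 0%N x) ^+ 2 + s)).
  have := rnormD_le (f 0%N x) (g x - f 0%N x); rewrite subrKC rnormB_sym.
  rewrite -(@ler_pXn2r _ 2)// ?nnegrE ?addr_ge0 ?rnorm_ge0//.
  have := sqr_ge0 (rnorm (f 0%N x) - rnorm (f 0%N x - g x)).
  by move: fgs; move: (rnorm _) (rnorm _) (rnorm _) => *; lra.
exists (L2_class hH sg).
have uf : {ae mu, forall x, forall n, u n x = f n x}.
  exists N; split=> // x /= /existsNP[n unf]; apply: contrapT => nNx; apply: unf.
  by rewrite /f indicE mem_set// scale1r.
apply: (cvg_L2_dominated ih) => [n|].
  by apply: filterS2 uf (L2_classE hH sg) => x -> ->.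
apply: filterS2 uf (L2_classE hH sg) => x ufx ->.
by rewrite (_ : (fun n => _) = (fun n => rnorm (f n x - g x)))//; apply/funext => n; rewrite ufx.
Qed.

(** Centres u n are chosen of balls of radius 4^-(n+2) belonging to F. Successive balls intersect,
    so the distance from u n to u (n+1) is below 4^-(n+1), as [L2_fast_cauchy_cvg] demands. The
    filter then has the limit of the centres. *)
Lemma L2_complete (F : set_system L2) : ProperFilter F -> cauchy F -> cvg F.
Proof.
move=> PF /cauchyP cF.
have Fu n : exists u : L2, F [set v | rnorm (u - v) < 4^-1 ^+ n.+2].
  have e0 : 0 < ((4^-1 : R) ^+ n.+2)%:C%C by rewrite ltcR exprn_gt0// invr_gt0.
  by have [u] := cF _ e0; rewrite ball_rnormE//; exists u.
have /choice[u uF] := Fu.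
have [n|l ul] := @L2_fast_cauchy_cvg u.
  have [v [/= v1 v2]] := filter_ex (filterI (uF n.+1) (uF n)).
  have := rnormD_le (u n.+1 - v) (v - u n); rewrite addrA subrK [rnorm (v - _)]rnormB_sym.
  have p0 : 0 < (4^-1 : R) ^+ n.+1 by rewrite exprn_gt0// invr_gt0.
  by move: v1 v2; rewrite 2!exprS; move: p0 (rnorm _) (rnorm _) (rnorm _); rewrite exprS => *; lra.
apply/cvg_ex; exists l; apply/cvgrPdist_lt => e e0; have [{}e0 eE] := gt0_complexE e0.
have := @cvg_geometric R 1 4^-1.
rewrite ger0_norm ?invr_ge0// invf_lt1// ltr1n => /(_ isT).
have e20 : 0 < complex.Re e / 2 by rewrite divr_gt0.
move=> /cvgrPdist_lt/(_ _ e20)[N _ Ne].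
have vl0 : rnorm (u i - l) @[i --> \oo] --> 0 by exact: cvg_rnormB.
move/cvgrPdist_lt : vl0 => /(_ _ e20)[M _ Me].
pose n := (N + M)%N.
have := Me n (leq_addl _ _); rewrite /= sub0r normrN ger0_norm ?rnorm_ge0// => unl.
have := Ne n.+2 (leq_trans (leq_addr M N) (leq_trans (leqnSn _) (leqnSn _))).
rewrite /= mul1r sub0r normrN => /(le_lt_trans (ler_norm _)) pe.
apply: filterS (uF n) => v /= uv; rewrite eE rnormE ltcR.
have := rnormD_le (l - u n) (u n - v); rewrite addrA subrK [rnorm (l - _)]rnormB_sym.
by move: unl pe uv; move: (rnorm _) (rnorm _) (rnorm _) (_ ^+ _) (complex.Re _) => *; lra.
Qed.

End L2_complete.

(** * Separability of L2 *)

Section countable_span.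
Context {R : realType} {H : preHilbertType R} {I : countType} (e : I -> H).
Implicit Types (x y : H) (s : seq (bool * I)).

(** Coefficients are signs, so the combinations are indexed by a countable type and closed under
    subtraction; in the application, scaling is absorbed by a dense sequence of vectors among the
    generators. *)
Definition integer_comb s : H := \sum_(p <- s) (-1) ^+ p.1 *: e p.2.

Definition span_closure : set H :=
  [set x | forall r : R, 0 < r -> exists s, rnorm (x - integer_comb s) < r].

Lemma span_closure_gen i : span_closure (e i).
Proof.
move=> r r0; exists [:: (false, i)].
by rewrite /integer_comb big_seq1 scale1r subrr rnorm0.
Qed.

Lemma span_closureB x y : span_closure x -> span_closure y -> span_closure (x - y).
Proof.
move=> Vx Vy r r0; have r20 : 0 < r / 2 by rewrite divr_gt0.
have [s xs] := Vx _ r20; have [t yt] := Vy _ r20.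
exists (s ++ [seq (~~ p.1, p.2) | p <- t]).
have -> : integer_comb (s ++ [seq (~~ p.1, p.2) | p <- t]) = integer_comb s - integer_comb t.
  rewrite /integer_comb big_cat big_map -sumrN; congr (_ + _); apply: eq_bigr => -[b i] _ /=.
  by rewrite signrN scaleNr.
have -> : x - y - (integer_comb s - integer_comb t) =
    (x - integer_comb s) - (y - integer_comb t).
  by rewrite !opprB addrACA [RHS]addrACA [- y - _]addrC.
have := rnormD_le (x - integer_comb s) (- (y - integer_comb t)); rewrite rnormN.
by move: xs yt; move: (rnorm _) (rnorm _) (rnorm _) => *; lra.
Qed.

Lemma span_closure0 : span_closure 0.
Proof. by move=> r r0; exists [::]; rewrite /integer_comb big_nil subrr rnorm0. Qed.

Lemma span_closureD x y : span_closure x -> span_closure y -> span_closure (x + y).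
Proof.
move=> Vx Vy; rewrite -[y]opprK -[- y]sub0r; apply: span_closureB => //.
exact: span_closureB span_closure0 Vy.
Qed.

Lemma span_closure_cvg (f : nat -> H) x :
  (forall n, span_closure (f n)) -> f @ \oo --> x -> span_closure x.
Proof.
move=> Vf fx r r0; have r20 : 0 < r / 2 by rewrite divr_gt0.
have fx0 : rnorm (f i - x) @[i --> \oo] --> 0 by exact: cvg_rnormB.
move/cvgrPdist_lt : fx0 => /(_ _ r20)[N _ /(_ N (leqnn N))].
rewrite /= sub0r normrN ger0_norm ?rnorm_ge0// => fNx.
have [s fNs] := Vf N _ r20; exists s.
have := rnormD_le (x - f N) (f N - integer_comb s); rewrite addrA subrK [rnorm (x - _)]rnormB_sym.
by move: fNx fNs; move: (rnorm _) (rnorm _) (rnorm _) => *; lra.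
Qed.

Lemma span_closure_separable : span_closure = setT -> separable H.
Proof.
move=> VT; exists (range integer_comb).
  by apply: (card_le_trans (card_image_le _ _)); exact: countableP.
move=> O [x Ox] oO; have : nbhs x O by exact: open_nbhs_nbhs.
move=> /nbhs_ballP[r /= r0]; rewrite ball_rnormE// => rO.
have Vx : span_closure x by rewrite VT.
have [{}r0 _] := gt0_complexE r0; have [s xs] := Vx _ r0.
by exists (integer_comb s); split; [exact: rO|exists s].
Qed.

End countable_span.

Section L2_separable.
Context {R : realType} {H : preHilbertType R} d {T : measurableType d}.
Variables (mu : {measure set T -> \bar R}) (hH : separable_hilbert H).
Local Notation L2 := (L2 mu hH).
Local Notation "1_ A c" := (fun x : T => (\1_A x : R[i]) *: c) (at level 10, A at level 8, c at level 9).

Lemma sq_integrable_indic_cst (A : set T) (c : H) : measurable A -> (mu A < +oo)%E ->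
  sq_integrable mu (1_ A c).
Proof.
move=> mA Aoo.
have b : borel_fun (1_ A c).
  apply/borel_funP => U oU; rewrite (_ : _ @^-1` U =
      if `[< U c >] then (if `[< U 0 >] then setT else A)
                    else (if `[< U 0 >] then ~` A else set0)).
    by do 2 case: ifP => _ //; exact: measurableC.
  apply/seteqP; split=> x /=; rewrite indicE.
    have [Ax|nAx] := boolP (x \in A).
      by rewrite scale1r => Uc; rewrite asboolT//; case: ifP => _ //; exact: set_mem.
    rewrite scale0r => U0; rewrite [in `[< U 0 >]]asboolT//; case: ifP => // _ Ax.
    by move: nAx; rewrite mem_set.
  case: asboolP => Uc; case: asboolP => U0 //=.
  - by case: (x \in A); rewrite ?scale1r ?scale0r.
  - by move=> Ax; rewrite mem_set// scale1r.
  - by move=> nAx; rewrite memNset// scale0r.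
split=> //.
have -> : (fun x => (rnorm ((\1_A x : R[i]) *: c) ^+ 2)%:E) =
    (fun x => (rnorm c ^+ 2)%:E * (\1_A x)%:E)%E.
  apply/funext => x; rewrite -EFinM !indicE; case: (x \in A).
    by rewrite scale1r mulr1.
  by rewrite scale0r rnorm0 mulr0 expr0n.
rewrite ge0_integralZl_EFin ?sqr_ge0//; last by apply/measurable_EFinP; exact: measurable_indic.
by rewrite integral_indic// setIT lte_mul_pinfty// lee_fin sqr_ge0.
Qed.

Lemma integrable_rnorm2_cst (A : set T) (c : H) : measurable A -> (mu A < +oo)%E ->
  mu.-integrable setT (fun x => (rnorm ((\1_A x : R[i]) *: c) ^+ 2)%:E).
Proof. by move=> mA Aoo; have [] := (sq_integrableP _ _).1 (sq_integrable_indic_cst c mA Aoo). Qed.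

Variables (b : nat -> set T) (E : nat -> set T) (c : nat -> H).
Hypothesis bT : @measurable _ T = <<s range b >>.
Hypothesis mE : forall n, measurable (E n).
Hypothesis Eoo : forall n, (mu (E n) < +oo)%E.
Hypothesis ET : \bigcup_n E n = setT.
Hypothesis cH : forall x (r : R), 0 < r -> exists i, rnorm (x - c i) < r.

(** Finite intersections turn the countable generating family into a countable pi-system, as Dynkin
    induction requires. *)
Definition base_meet (s : seq nat) : set T := foldr (fun i A => b i `&` A) setT s.

Let mb i : measurable (b i).
Proof. by rewrite bT; apply: sub_sigma_algebra; exists i. Qed.

Lemma measurable_base_meet s : measurable (base_meet s).
Proof. by elim: s => //= i s ih; exact: measurableI. Qed.

Lemma base_meet_cat s t : base_meet (s ++ t) = base_meet s `&` base_meet t.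
Proof. by elim: s => [|i s ih] /=; rewrite ?setTI// ih setIA. Qed.

Lemma base_meet_setI_closed : setI_closed (range base_meet).
Proof. by move=> _ _ [s _ <-] [t _ <-]; exists (s ++ t) => //; rewrite base_meet_cat. Qed.

Lemma base_meet_generates : @measurable _ T = <<s range base_meet >>.
Proof.
apply/seteqP; split=> A.
  rewrite bT; apply: smallest_sub => [|_ [i _ <-]]; first exact: smallest_sigma_algebra.
  by apply: sub_sigma_algebra; exists [:: i] => //=; rewrite setIT.
apply: smallest_sub => [|_ [s _ <-]]; last exact: measurable_base_meet.
by rewrite bT; exact: smallest_sigma_algebra.
Qed.

Let mEI A n : measurable A -> measurable (A `&` E n).
Proof. by move=> mA; exact: measurableI. Qed.

Let EIoo A n : measurable A -> (mu (A `&` E n) < +oo)%E.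
Proof.
move=> mA; apply: le_lt_trans (Eoo n); apply: le_measure; rewrite ?inE//; exact: mEI.
Qed.

Definition gen (p : seq nat * nat * nat) : L2 :=
  L2_class hH (sq_integrable_indic_cst (c p.2) (mEI p.1.2 (measurable_base_meet p.1.1))
    (EIoo p.1.2 (measurable_base_meet p.1.1))).

Local Notation V := (span_closure gen).

(** Membership in V is transported from classes to functions, where pointwise identities can be
    rewritten. *)
Definition approximable (f : T -> H) : Prop :=
  exists2 u : L2, V u & {ae mu, forall x, u x = f x}.

Lemma approximableB f g : approximable f -> approximable g -> approximable (f \- g).
Proof.
move=> [u Vu uf] [v Vv vg]; exists (u - v); first exact: span_closureB.
by apply: filterS (filterI (L2_subE u v) (filterI uf vg)) => x [-> [-> ->]].
Qed.

Lemma approximableD f g : approximable f -> approximable g -> approximable (f \+ g).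
Proof.
move=> [u Vu uf] [v Vv vg]; exists (u + v); first exact: span_closureD.
by apply: filterS (filterI (L2_addE u v) (filterI uf vg)) => x [-> [-> ->]].
Qed.

Lemma approximable0 : approximable (fun=> 0).
Proof. by exists 0; [exact: span_closure0|exact: L2_zeroE]. Qed.

Lemma approximable_dominated (f : nat -> T -> H) (g : T -> H) (h : T -> \bar R) :
  (forall n, approximable (f n)) -> sq_integrable mu g -> mu.-integrable setT h ->
  (forall n x, ((rnorm (f n x - g x) ^+ 2)%:E <= h x)%E) ->
  (forall x, rnorm (f n x - g x) @[n --> \oo] --> 0) -> approximable g.
Proof.
move=> Af sg ih fgh fg0.
have /choice[u uf] n : exists u : L2, V u /\ {ae mu, forall x, u x = f n x}.
  by have [u Vu uf] := Af n; exists u.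
have ufE := ae_foralln (fun n => (uf n).2).
exists (L2_class hH sg); last exact: L2_classE.
apply: (span_closure_cvg (f := u)) => [n|]; first by have [] := uf n.
apply: (cvg_L2_dominated ih) => [n|].
  by apply: filterS2 ufE (L2_classE hH sg) => x -> ->.
apply: filterS2 ufE (L2_classE hH sg) => x ufx ->.
by rewrite (_ : (fun n => _) = (fun n => rnorm (f n x - g x)))//; apply/funext => n; rewrite ufx.
Qed.

(** Dynkin induction on A: the pi-system gives generators, complements are differences from [setT],
    and disjoint unions are dominated limits of partial sums. Intersecting with E n keeps all
    measures finite. *)
Lemma approximable_indic_dense A n j : measurable A -> approximable (1_ (A `&` E n) (c j)).
Proof.
rewrite base_meet_generates; move: A; apply: dynkin_induction.
- exact: base_meet_generates.
- exact: base_meet_setI_closed.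
- by exists (gen ([::], n, j)); [exact: span_closure_gen|exact: L2_classE].
- by move=> _ [s _ <-]; exists (gen (s, n, j)); [exact: span_closure_gen|exact: L2_classE].
- move=> A mA aA.
  have aT : approximable (1_ (setT `&` E n) (c j)).
    by exists (gen ([::], n, j)); [exact: span_closure_gen|exact: L2_classE].
  rewrite (_ : 1_ _ _ = (1_ (setT `&` E n) (c j)) \- (1_ (A `&` E n) (c j))); first exact: approximableB.
  apply/funext => x; rewrite /= -scalerBl; congr (_ *: _); rewrite !indicE !in_setI in_setC in_setT.
  by case: (x \in A); case: (x \in E n); rewrite ?subrr ?subr0.
move=> F mF tF aF.
pose f N := fun x => \sum_(i < N) (\1_(F i `&` E n) x : R[i]) *: c j.
pose g := 1_ ((\bigcup_i F i) `&` E n) (c j).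
(* By disjointness only the index k of the set containing x contributes; where g vanishes, k = 0
   serves. *)
have fE x : exists k, forall N, f N x = if (k < N)%N then g x else 0.
  have [[k [Fkx Ex]]|nFx] := pselect (exists k, F k x /\ E n x); last first.
    exists 0%N => N; rewrite /g indicE memNset; last by move=> [[k _ Fkx] Ex]; apply: nFx; exists k.
    rewrite scale0r if_same /f big1// => i _; rewrite indicE memNset ?scale0r// => -[Fix Ex].
    by apply: nFx; exists i.
  exists k => N; rewrite /g indicE mem_set; last by split=> //; exists k.
  rewrite scale1r /f; elim: N => [|N ih]; first by rewrite big_ord0.
  rewrite big_ord_recr/= ih indicE ltnS; case: (ltngtP k N) => [kN|Nk|kN].
  - rewrite memNset ?scale0r ?addr0// => -[FNx _].
    by move: kN; rewrite (tF k N)// ?ltnn//; exists x.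
  - rewrite memNset ?scale0r ?addr0// => -[FNx _].
    by move: Nk; rewrite (tF k N)// ?ltnn//; exists x.
  - by rewrite -kN mem_set// scale1r add0r.
have mUF := bigcupT_measurable _ mF.
apply: (approximable_dominated (f := f)) (integrable_rnorm2_cst (c j) (mEI n mUF) (EIoo n mUF)) _ _.
- elim=> [|N ih].
    rewrite (_ : f 0%N = fun=> 0); first exact: approximable0.
    by apply/funext => x; rewrite /f big_ord0.
  rewrite (_ : f N.+1 = f N \+ (1_ (F N `&` E n) (c j))); first exact: approximableD.
  by apply/funext => x; rewrite /f big_ord_recr.
- by apply: sq_integrable_indic_cst; [exact: mEI|exact: EIoo].
- move=> N x; have [k ->] := fE x; rewrite -/(g x) lee_fin; case: ifP => _.
    by rewrite subrr rnorm0 expr0n sqr_ge0.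
  by rewrite sub0r rnormN.
move=> x; have [k fk] := fE x; apply: (cvg_near_cst (0 : R)).
by exists k.+1 => // N /= kN; rewrite fk kN subrr rnorm0.
Qed.

(** Vectors of the dense sequence within 1/(k+1) of y replace it; the squared errors are dominated
    by the indicator of the set. *)
Lemma approximable_indic A n (y : H) : measurable A -> approximable (1_ (A `&` E n) y).
Proof.
move=> mA.
have /choice[i yi] k : exists i, rnorm (y - c i) < k.+1%:R^-1 by apply: cH; rewrite invr_gt0.
have yi1 k : rnorm (c (i k) - y) <= 1.
  rewrite rnormB_sym; apply/ltW/(lt_le_trans (yi k)).
  by rewrite invf_le1// ler1n.
have I1 : mu.-integrable setT (fun x => (\1_(A `&` E n) x)%:E).
  apply/integrableP; split.
    by apply/measurable_EFinP; apply: measurable_indic; exact: mEI.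
  under eq_integral do rewrite gee0_abs ?lee_fin//.
  by rewrite integral_indic ?setIT//; [exact: EIoo|exact: mEI].
have sE k x : (\1_(A `&` E n) x : R[i]) *: c (i k) - (\1_(A `&` E n) x : R[i]) *: y =
    (\1_(A `&` E n) x : R[i]) *: (c (i k) - y) by rewrite scalerBr.
apply: (approximable_dominated (f := fun k => 1_ (A `&` E n) (c (i k)))) I1 _ _.
- by move=> k; exact: approximable_indic_dense.
- by apply: sq_integrable_indic_cst; [exact: mEI|exact: EIoo].
- move=> k x; rewrite sE lee_fin !indicE; case: (x \in _).
    by rewrite scale1r expr_le1 ?rnorm_ge0.
  by rewrite scale0r rnorm0 expr0n.
move=> x; apply: (@squeeze_cvgr _ _ _ _ (cst 0) (fun k => k.+1%:R^-1)).
- apply: nearW => k; rewrite rnorm_ge0/= sE indicE; case: (x \in _).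
    by rewrite scale1r rnormB_sym ltW.
  by rewrite scale0r rnorm0 invr_ge0.
- exact: cvg_cst.
- exact: cvg_harmonic.
Qed.

(* Keeping the nearest of the vectors met so far, starting from 0, makes the error
   decrease to 0 while staying below |f|. *)
Fixpoint nearest (f : T -> H) N : T -> H := if N isn't N'.+1 then fun=> 0 else
  let phi := nearest f N' in
  if unpickle N' is Some (i, n) then
    fun x => if `[< E n x /\ rnorm (f x - c i) < rnorm (f x - phi x) >] then c i else phi x
  else phi.

Lemma nearest_le f N x : rnorm (f x - nearest f N x) <= rnorm (f x).
Proof.
elim: N => [|N ih] /=; first by rewrite subr0.
by case: unpickle => [[i n]|//]; case: asboolP => // -[_ /ltW/le_trans]; apply.
Qed.

Lemma nearest_homo f x : {homo (fun N => rnorm (f x - nearest f N x)) : M N / (M <= N)%N >-> N <= M}.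
Proof.
apply/nonincreasing_seqP => N /=.
by case: unpickle => [[i n]|//]; case: asboolP => // -[_ /ltW].
Qed.

(** A pair (i, n) with c i within r of f x and x in E n is examined at step [pickle (i, n)]; from
    then on the error stays below r by monotonicity. *)
Lemma nearest_cvg f x : rnorm (nearest f N x - f x) @[N --> \oo] --> 0.
Proof.
apply/cvgrPdist_lt => r r0; have [i fi] := cH (f x) r0.
have [n _ En] : (\bigcup_n E n) x by rewrite ET.
exists (pickle (i, n)).+1 => // N /= /(nearest_homo f x)/= fN.
rewrite sub0r normrN ger0_norm ?rnorm_ge0// rnormB_sym.
apply: le_lt_trans fN _; rewrite pickleK; case: asboolP => // /not_andP[//|/negP].
by rewrite -leNgt => /le_lt_trans; apply.
Qed.

(** The quantification over A strengthens the induction: each step keeps the previous approximant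
    only off a measurable set B, so its restrictions must be approximable too. *)
Lemma nearestP f : sq_integrable mu f -> forall N, sq_integrable mu (nearest f N) /\
  forall A, measurable A -> approximable (fun x => (\1_A x : R[i]) *: nearest f N x).
Proof.
move=> sf; elim=> [|N [sN aN]] /=.
  split; first exact: sq_integrable0.
  by move=> A mA; under eq_fun do rewrite scaler0; exact: approximable0.
case: (unpickle N) => [[i n]|]; last by [].
pose B := E n `&` [set x | rnorm (f x - c i) < rnorm (f x - nearest f N x)].
have mB : measurable B.
  apply: measurableI => //; rewrite -[X in measurable X]setTI.
  have bd (g : T -> H) : borel_fun g -> measurable_fun setT (fun x => rnorm (f x - g x)).
    move=> bg; rewrite (_ : (fun x => _) = rnorm \o (f \+ (-1 \*: g))).
      apply: borel_fun_rnorm; apply: (borel_funD (hilbert_separable hH)) sf.1 _.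
      exact: (borel_funZ (hilbert_separable hH)).
    by apply/funext => x /=; rewrite scaleN1r.
  have bc : borel_fun (fun _ : T => c i) by exact: measurable_cst.
  have mtrue : measurable [set true] by [].
  by have := measurable_fun_ltr (bd _ bc) (bd _ sN.1) measurableT mtrue.
(* Here B is contained in E n; the intersection is displayed to match [approximable_indic]. *)
have nE x : (if `[< E n x /\ rnorm (f x - c i) < rnorm (f x - nearest f N x) >]
    then c i else nearest f N x) =
    (\1_(~` B) x : R[i]) *: nearest f N x + (\1_(B `&` E n) x : R[i]) *: c i.
  rewrite !indicE in_setC in_setI; case: asboolP => Bx.
    by rewrite (mem_set (Bx : B x)) (mem_set Bx.1) scale0r add0r scale1r.
  by rewrite (memNset (Bx : ~ B x)) scale0r addr0 scale1r.
rewrite (funext nE); split.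
  apply: (sq_integrableD hH).
    exact: sq_integrable_indic (measurableC mB) sN.
  by apply: sq_integrable_indic_cst; [exact: mEI|exact: EIoo].
move=> A mA.
rewrite (_ : (fun x => _) = (fun x => (\1_(A `&` ~` B) x : R[i]) *: nearest f N x) \+ (1_ ((A `&` B) `&` E n) (c i))).
  apply: approximableD; last by apply: approximable_indic; exact: measurableI.
  by apply: aN; apply: measurableI => //; exact: measurableC.
apply/funext => x /=; rewrite nE scalerDr !scalerA !indicE !in_setI in_setC.
by case: (x \in A); case: (x \in B); case: (x \in E n); rewrite ?mul1r ?mul0r.
Qed.

Lemma approximable_sq_integrable f : sq_integrable mu f -> approximable f.
Proof.
move=> sf; have [_ If] := (sq_integrableP _ _).1 sf.
apply: (approximable_dominated (f := nearest f)) If _ _ => //.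
- move=> N; have := (nearestP sf N).2 _ (measurableT).
  by rewrite (_ : (fun x => _) = nearest f N)//; apply/funext => x; rewrite indicT scale1r.
- move=> N x; rewrite lee_fin rnormB_sym ler_pXn2r ?nnegrE ?rnorm_ge0//.
  exact: nearest_le.
- exact: nearest_cvg.
Qed.

Lemma span_closure_gen_full : V = setT.
Proof.
apply/seteqP; split=> u // _; have [v Vv vu] := approximable_sq_integrable (L2_sq u).
by rewrite (_ : u = v)//; apply: L2_eq; apply: filterS vu => x ->.
Qed.

Lemma L2_separable_of_base : separable L2.
Proof. exact: span_closure_separable span_closure_gen_full. Qed.

End L2_separable.

Lemma L2_separable (R : realType) (H : preHilbertType R) d (T : measurableType d)
    (mu : {sigma_finite_measure set T -> \bar R}) (hH : separable_hilbert H)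
    (b : nat -> set T) :
  @measurable _ T = <<s range b >> -> separable (L2 mu hH).
Proof.
move=> bT; have [E ET mE] := sigma_finiteT mu.
have [c cH] := dense_sequence (hilbert_separable hH).
by apply: (L2_separable_of_base hH bT _ _ (esym ET) cH) => n; have [] := mE n.
Qed.

(** * The canonical localizations *)

Section countable_bases.

Definition countable_basis (X : topologicalType) (b : nat -> set X) : Prop :=
  (forall n, open (b n)) /\
  (forall x U, nbhs x U -> exists n, b n x /\ b n `<=` U).

Lemma countable_basis_reindex (X : topologicalType) (I : countType) (b : I -> set X) :
  (forall i, open (b i)) -> (forall x U, nbhs x U -> exists i, b i x /\ b i `<=` U) ->
  countable_basis (fun n => if unpickle n is Some i then b i else set0).
Proof.
move=> ob nb; split=> [n|x U /nb[i [bix iU]]].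
  by case: unpickle => [i|]; [exact: ob|exact: open0].
by exists (pickle i); rewrite pickleK.
Qed.

Lemma countable_basis_sigma_algebra (X : topologicalType) (b : nat -> set X) :
  countable_basis b -> <<s @open X >> = <<s range b >>.
Proof.
move=> [ob nb]; apply/seteqP; split=> A; apply: smallest_sub => [|U].
- exact: smallest_sigma_algebra.
- move=> oU; have -> : U = \bigcup_n (if `[< b n `<=` U >] then b n else set0).
    apply/seteqP; split=> x; last by move=> [n _]; case: ifP => // /asboolP nU /nU.
    move=> Ux; have [n [bnx nU]] := nb x U (open_nbhs_nbhs (conj oU Ux)).
    by exists n => //; rewrite asboolT.
  apply: sigma_algebra_bigcup => n; case: ifP => _; last exact: sigma_algebra0.
  by apply: sub_sigma_algebra; exists n.
- exact: smallest_sigma_algebra.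
- by move=> [n _ <-]; apply: sub_sigma_algebra.
Qed.

Lemma countable_basis_real (R : realType) : exists b : nat -> set R, countable_basis b.
Proof.
eexists; apply: (@countable_basis_reindex R (rat * rat)%type
  (fun p => `]ratr p.1, ratr p.2[%classic)) => [p|x U].
  exact: interval_open.
move=> /nbhs_ballP[e /= e0 eU].
have /rat_in_itvoo[p] : x - e < x by rewrite ltrBlDr ltrDl.
have /rat_in_itvoo[q] : x < x + e by rewrite ltrDl.
rewrite !in_itv /= => /andP[xq qe] /andP[ep px].
exists (p, q); split; first by rewrite /= in_itv /= px xq.
move=> y /=; rewrite in_itv /= => /andP[py yq]; apply: eU.
by rewrite /ball /= ltr_norml; apply/andP; split; lra.
Qed.

Lemma countable_basis_rV (R : realType) n :
  exists b : nat -> set 'rV[R]_n, countable_basis b.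
Proof.
have [b [ob nb]] := countable_basis_real R.
eexists; apply: (@countable_basis_reindex 'rV[R]_n {ffun 'I_n -> nat}
  (fun f => [set M | forall j, b (f j) (M ord0 j)])) => [f|M U].
  rewrite openE => M /= bM; exists (fun _ j => b (f j)) => [i j|N /= bN j].
    by rewrite ord1; apply: open_nbhs_nbhs.
  exact: bN.
move=> [P /= MP PU].
have /choice[f fP] j : exists k, b k (M ord0 j) /\ b k `<=` P ord0 j by exact: nb.
exists [ffun j => f j]; split=> [j|N /= bN]; first by rewrite ffunE; case: (fP j).
by apply: PU => i j; rewrite ord1; apply: (fP j).2; have := bN j; rewrite ffunE.
Qed.

Lemma countable_basis_set_type (X : topologicalType) (A : set X) (b : nat -> set X) :
  countable_basis b -> exists b' : nat -> set A, countable_basis b'.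
Proof.
move=> [ob nb]; exists (fun n => \val @^-1` b n); split=> [n|x U].
  by apply: open_comp (ob n) => y _; exact: initial_continuous.
rewrite nbhsE => -[V [[W oW <-] Wx] VU].
have [n [bnx nW]] := nb (\val x) W (open_nbhs_nbhs (conj oW Wx)).
by exists n; split=> // y /nW; exact: VU.
Qed.

Lemma countable_basis_prod (X Y : topologicalType) (b : nat -> set X) (b' : nat -> set Y) :
  countable_basis b -> countable_basis b' ->
  exists b'' : nat -> set (X * Y), countable_basis b''.
Proof.
move=> [ob nb] [ob' nb']; eexists.
apply: (@countable_basis_reindex (X * Y)%type (nat * nat)%type
  (fun p => b p.1 `*` b' p.2)) => [p|[x y] U].
  rewrite (_ : _ `*` _ = fst @^-1` b p.1 `&` snd @^-1` b' p.2)//.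
  by apply: openI; apply: open_comp => // z _; [exact: cvg_fst|exact: cvg_snd].
move=> xyU; have [[P Q] /= [xP yQ] PQ] : filter_prod (nbhs x) (nbhs y) U by [].
have [i [bix iP]] := nb x P xP; have [j [bjy jQ]] := nb' y Q yQ.
exists (i, j); split=> // -[z w] /= [zP wQ]; apply: PQ; split; [exact: iP|exact: jQ].
Qed.

Lemma countable_basis_timelike_lines (R : realType) :
  exists b : nat -> set (timelike_lines R), countable_basis b.
Proof.
have [b cb] := countable_basis_rV R 3.
have [b' cb'] := countable_basis_set_type (@velocities R) cb.
exact: countable_basis_prod cb cb'.
Qed.

End countable_bases.

Section canonical_localizations.
Context {R : realType} {Hd : preHilbertType R}.
Variables (m : {sigma_finite_measure set (borel (timelike_lines R)) -> \bar R})
  (hHd : separable_hilbert Hd).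

Lemma separable_hilbert_L2 : separable_hilbert (L2 m hHd).
Proof.
split; first by move=> F PF; exact: L2_complete.
have [b cb] := countable_basis_timelike_lines R.
exact: (L2_separable (T := borel _) m hHd (countable_basis_sigma_algebra cb)).
Qed.

Lemma Fcan_representation : causal_logic_representation (Fcan m hHd).
Proof.
have mM M : causal_logic M -> orthogonal_projection (Fcan m hHd M).
  move=> /measurable_lines_causal_logic mM; apply: Ecan_projection.
  exact: completion_measurable_measurable.
split.
- exact: separable_hilbert_L2.
- by move=> M /mM[].
- by move=> M /mM; exact: orthogonal_projection_ge0.
- by move=> u; rewrite /Fcan lines_meeting0 Ecan_set0.
move=> M cM oM MT; apply: Ecan_series.
- by move=> n; exact: measurable_lines_causal_logic.
- apply/trivIsetP => i j _ _ /eqP ij; apply: orthogonal_sets_lines; exact: oM.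
- exact: causal_logic_cover.
Qed.

Lemma Tcan_localization : achronal_localization (Tcan m hHd).
Proof.
have mD D : borel_achronal D -> orthogonal_projection (Tcan m hHd D).
  move=> /measurable_lines_achronal mD; apply: Ecan_projection.
  exact: completion_measurable_measurable.
split.
- exact: separable_hilbert_L2.
- by move=> D /mD[].
- by move=> D /mD; exact: orthogonal_projection_ge0.
- by move=> u; rewrite /Tcan lines_meeting0 Ecan_set0.
move=> D bD tD maxD; apply: Ecan_series.
- by move=> n; exact: measurable_lines_achronal.
- apply/trivIsetP => i j _ _ ij; apply: achronal_sets_lines; last first.
    by move/trivIsetP : tD; apply.
  by move=> x y [Dx|Dx] [Dy|Dy]; apply: maxD.1; do [by exists i|by exists j].
- rewrite -lines_meeting_bigcup lines_meetingE; apply/seteqP; split=> u // _ /=.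
  exact: maximal_achronal_meets.
Qed.

End canonical_localizations.

Theorem mainTheorem2 (R : realType)
    (m : {sigma_finite_measure set (borel (timelike_lines R)) -> \bar R})
    (Hd : preHilbertType R) (hHd : separable_hilbert Hd) :
  [/\ forall M, causal_logic M -> completion_measurable m (lines_meeting M),
      causal_logic_representation (Fcan m hHd) &
      forall M, causal_logic M -> orthogonal_projection (Fcan m hHd M)]
  /\
  [/\ forall D, borel_achronal D -> completion_measurable m (lines_meeting D),
      achronal_localization (Tcan m hHd) &
      forall D, borel_achronal D -> orthogonal_projection (Tcan m hHd D)].
Proof.
have cM M : causal_logic M -> completion_measurable m (lines_meeting M).
  move=> /measurable_lines_causal_logic mM.
  exact: (@completion_measurable_measurable _ _ (borel _) m _ mM).
have cD D : borel_achronal D -> completion_measurable m (lines_meeting D).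
  move=> /measurable_lines_achronal mD.
  exact: (@completion_measurable_measurable _ _ (borel _) m _ mD).
split; split=> //.
- exact: Fcan_representation.
- by move=> M /cM; exact: Ecan_projection.
- exact: Tcan_localization.
- by move=> D /cD; exact: Ecan_projection.
Qed.
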